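(* Let $G(x,y)\in k[[x,y]]$ be a one-dimensional formal group law of finite height defined over a field $k$ of characteristic $p>0$, with $k$ large enough that all endomorphisms of $G$ (over an algebraic closure of $k$) are defined over $k$. Then $\mathrm{Aut}_k(G)$ is its own normalizer in $k[[x]]^\circ$; that is, if $\psi\in k[[x]]^\circ$ satisfies $\psi\circ u\circ\psi^{\circ(-1)}\in\mathrm{Aut}_k(G)$ for every $u\in\mathrm{Aut}_k(G)$, then $\psi\in\mathrm{Aut}_k(G)$.
   Context: $k[[x]]^\circ$ denotes the group, under composition, of all invertible power series over $k$, i.e. series $\psi(x)=\sum_{n\ge1}c_nx^n$ with $c_1\neq0$. The height $h$ of $G$ is defined by $v_x([p]_G(x))=p^h$. $\mathrm{End}_k(G)$ is the set of series $f\in xk[[x]]$ with $f(G(x,y))=G(f(x),f(y))$, and $\mathrm{Aut}_k(G)$ is its group of composition-invertible elements. *)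

(* Defs.v *)
From HB Require Import structures.
From mathcomp Require Import all_boot all_order all_algebra.
From mathcomp Require Import mpoly.

Set Implicit Arguments.
Unset Strict Implicit.
Unset Printing Implicit Defensive.

Import GRing.Theory.
Local Open Scope ring_scope.

(* The power series ring R[[x_0, ..., x_(n-1)]]: a series is its family of
   coefficients, indexed by exponent vectors. Equality of series is =1. *)
Definition series (R : Type) (n : nat) : Type := 'X_{1..n} -> R.

Section Series.
Variable R : comNzRingType.

Definition szero {n} : series R n := fun _ => 0.

Definition svar {n} (i : 'I_n) : series R n := fun e => (e == U_(i)%MM)%:R.

(* The terms of f of total degree < d. *)
Definition strunc {n} (d : nat) (f : series R n) : {mpoly R[n]} :=
  \sum_(m : 'X_{1..n < d}) f m *: 'X_[m].

(* f(g_0, ..., g_(m-1)). When the g_i have no constant term, the coefficient of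
   x^e in it only involves the terms of f and of the g_i of degree <= |e|, so it
   can be read off the composite of the truncations. All uses below are with
   series g_i without constant term. *)
Definition ssubst {m n} (f : series R m) (g : 'I_m -> series R n) :
    series R n :=
  fun e => (strunc (mdeg e).+1 f \mPo
            [tuple strunc (mdeg e).+1 (g i) | i < m])@_e.

Definition pair2 {n} (f g : series R n) (i : 'I_2) : series R n :=
  if i == ord0 then f else g.

Definition ssubst2 {n} (F : series R 2) (f g : series R n) : series R n :=
  ssubst F (pair2 f g).

Definition scomp {n} (f : series R 1) (g : series R n) : series R n :=
  ssubst f (fun _ => g).

(* The variable x of R[[x]]. *)
Definition sX : series R 1 := svar ord0.

Definition no_constant_term {n} (f : series R n) : Prop := f 0%MM = 0.

(* The order of f is d; for n = 1 this reads v_x(f) = d. *)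
Definition has_order {n} (f : series R n) (d : nat) : Prop :=
  (exists2 e : 'X_{1..n}, mdeg e = d & f e != 0) /\
  (forall e : 'X_{1..n}, (mdeg e < d)%N -> f e = 0).

(* One-dimensional formal group laws. Neither the existence of inverses nor
   commutativity is required: the former is automatic, and so is the latter
   over a field (Lazard). *)
Definition formal_group_law (G : series R 2) : Prop :=
  [/\ no_constant_term G,
      ssubst2 G sX szero =1 sX,
      ssubst2 G szero sX =1 sX &
      ssubst2 G (ssubst2 G (svar (inord 0)) (svar (inord 1))) (svar (inord 2))
      =1 ssubst2 G (svar (inord 0))
           (ssubst2 G (svar (inord 1)) (svar (inord 2))) :> series R 3].

Fixpoint fg_mul (G : series R 2) (n : nat) : series R 1 :=
  if n is n'.+1 then ssubst2 G (fg_mul G n') sX else szero.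

Definition has_height (p : nat) (G : series R 2) (h : nat) : Prop :=
  has_order (fg_mul G p) (p ^ h)%N.

Definition fg_End (G : series R 2) (f : series R 1) : Prop :=
  no_constant_term f /\
  scomp f G =1 ssubst2 G (scomp f (svar (inord 0) : series R 2))
                         (scomp f (svar (inord 1))).

Definition comp_inverse (f g : series R 1) : Prop :=
  [/\ no_constant_term g, scomp f g =1 sX & scomp g f =1 sX].

Definition fg_Aut (G : series R 2) (f : series R 1) : Prop :=
  fg_End G f /\ exists2 g, fg_End G g & comp_inverse f g.

End Series.

Arguments szero {R n}.
Arguments svar {R n}.
Arguments sX {R}.

(* The underlying set of the group k[[x]]^o. *)
Definition invertible_series (k : fieldType) (f : series k 1) : Prop :=
  no_constant_term f /\ f U_(ord0)%MM != 0.

(* psi lies in k[[x]]^o and psi A psi^-1 = A, for A a subset of k[[x]]^o. *)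
Definition in_normalizer (k : fieldType) (A : series k 1 -> Prop)
    (psi : series k 1) : Prop :=
  invertible_series psi /\
  exists2 phi, comp_inverse psi phi &
    forall u, invertible_series u -> (A u <-> A (scomp (scomp psi u) phi)).

Definition smap (R S : Type) (n : nat) (iota : R -> S) (f : series R n) :
    series S n :=
  fun e => iota (f e).

(* Main.v *)
(* Let m = x k[[x]], a group under a + b := G(a, b), and let psi normalize
   Aut(G). The automorphism 1 + [p^n] is conjugated by psi to some
   1 + eps with eps in End(G) of order at least q = p^(hn). An endomorphism of
   order at least q is a series in x^q, so eps(psi(x)) = chi([p^n](x)) for some
   chi in m, that is psi(x + y) - psi(x) = chi(y) at y = [p^n](x). Expand
   psi(x + y) - psi(x) = sum_i P_i(x) y^i: since the order of [p^n] tends to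
   infinity, an induction on i shows that every P_i is constant, and x = 0 then
   gives psi(x + y) - psi(x) = psi(y). *)
From HB Require Import structures.
Require Import Defs.
From mathcomp Require Import all_boot all_order all_algebra.
From mathcomp Require Import mpoly.
From mathcomp Require boolp.
From mathcomp Require Import zify ring.

Set Implicit Arguments.
Unset Strict Implicit.
Unset Printing Implicit Defensive.

Import GRing.Theory.
Local Open Scope ring_scope.

(** Why eps(psi(x)) is a series in [p^n](x): Frobenius makes psi^q a series in x^q, so eps(psi),
    being a series in psi^q, is one in x^q as well. Moreover [p^n] = z(x^q), and since [p^n] has
    order exactly q, z is invertible under composition; so x^q is itself a series in [p^n](x).

    That an endomorphism f of order at least q is a series in x^q comes from a derivative: f(x + y)
    - f(x) is governed by f(y), which is too small for a nonzero first-order term in y. This is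
    repeated once for each factor p of q.

    The series chi depends on n. The induction on i therefore also pins down the i-th coefficient of
    every chi.

    Two matters shape the development. Commutativity of G is not part of the definition, yet 1 +
    [p^n] and eps are endomorphisms only because of it, so it is proved first. Identities in
    k[[x, y]] are handled on points, that is, on pairs of series in x without constant term; the
    points (x, x^M), M > 0, suffice to recover the identity. *)

Definition fps (R : comNzRingType) : Type := nat -> R.

HB.instance Definition _ (R : comNzRingType) := boolp.gen_eqMixin (fps R).
HB.instance Definition _ (R : comNzRingType) := boolp.gen_choiceMixin (fps R).

(** * The ring of power series in one variable and its x-adic filtration *)

Section FpsRing.
Variable R : comNzRingType.
Implicit Types f g h : fps R.

Lemma fpsP f g : f =1 g -> f = g.
Proof. exact: boolp.funext. Qed.

Definition fps_add f g : fps R := fun n => f n + g n.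
Definition fps_opp f : fps R := fun n => - f n.
Definition fps_mul f g : fps R := fun n => \sum_(i < n.+1) f i * g (n - i)%N.
Definition fps_const (c : R) : fps R := fun n => if n == 0%N then c else 0.

Definition fps_poly N f : {poly R} := \poly_(i < N) f i.

(** A coefficient of a product sees only finitely many terms, so commutativity and associativity of
    the product are inherited from [{poly R}] by truncation. *)
Lemma fps_mul_poly N f g n : (n < N)%N ->
  fps_mul f g n = (fps_poly N f * fps_poly N g)`_n.
Proof.
move=> nN; rewrite coefM /fps_mul; apply: eq_bigr => i _.
by rewrite !coef_poly ifT ?ifT //; have := ltn_ord i; lia.
Qed.

Lemma fps_addA : associative fps_add.
Proof. by move=> f g h; apply: fpsP => n; rewrite /fps_add addrA. Qed.
Lemma fps_addC : commutative fps_add.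
Proof. by move=> f g; apply: fpsP => n; rewrite /fps_add addrC. Qed.
Lemma fps_add0 : left_id (fps_const 0) fps_add.
Proof. by move=> f; apply: fpsP => n; rewrite /fps_add /fps_const if_same add0r. Qed.
Lemma fps_addN : left_inverse (fps_const 0) fps_opp fps_add.
Proof.
by move=> f; apply: fpsP => n; rewrite /fps_add /fps_const if_same /fps_opp addNr.
Qed.

HB.instance Definition _ := GRing.isZmodule.Build (fps R)
  fps_addA fps_addC fps_add0 fps_addN.

Lemma fps_mulC : commutative fps_mul.
Proof.
by move=> f g; apply: fpsP => n; rewrite !(@fps_mul_poly n.+1) // mulrC.
Qed.
Lemma fps_mulA : associative fps_mul.
Proof.
move=> f g h; apply: fpsP => n; rewrite !(@fps_mul_poly n.+1) //.
transitivity ((fps_poly n.+1 f * fps_poly n.+1 g * fps_poly n.+1 h)`_n).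
  rewrite -mulrA [LHS]coefM [RHS]coefM; apply: eq_bigr => i _; congr (_ * _).
  rewrite coef_poly ifT; last by have := ltn_ord i; lia.
  by apply: fps_mul_poly; have := ltn_ord i; lia.
rewrite [LHS]coefM [RHS]coefM; apply: eq_bigr => i _; congr (_ * _).
by rewrite coef_poly ltn_ord; apply/esym/fps_mul_poly; have := ltn_ord i; lia.
Qed.
Lemma fps_mul1 : left_id (fps_const 1) fps_mul.
Proof.
move=> f; apply: fpsP => n; rewrite /fps_mul big_ord_recl /fps_const /= mul1r subn0.
by rewrite big1 ?addr0 // => i _; rewrite mul0r.
Qed.
Lemma fps_mulDl : left_distributive fps_mul fps_add.
Proof.
move=> f g h; apply: fpsP => n; rewrite /fps_mul /fps_add -big_split /=.
by apply: eq_bigr => i _; rewrite mulrDl.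
Qed.
Lemma fps_1neq0 : fps_const 1 != fps_const 0.
Proof. by apply/eqP => /(congr1 (fun f => f 0%N)) /eqP; rewrite oner_eq0. Qed.

HB.instance Definition _ := GRing.Zmodule_isComNzRing.Build (fps R)
  fps_mulA fps_mulC fps_mul1 fps_mulDl fps_1neq0.

Lemma fcoef0 n : (0 : fps R) n = 0.
Proof. exact: if_same. Qed.
Lemma fcoefC0 n : (fps_const 0) n = 0.
Proof. exact: if_same. Qed.
Lemma fcoefD f g n : (f + g) n = f n + g n.
Proof. by []. Qed.
Lemma fcoefN f n : (- f) n = - f n.
Proof. by []. Qed.
Lemma fcoefB f g n : (f - g) n = f n - g n.
Proof. by []. Qed.
Lemma fcoefM f g n : (f * g) n = \sum_(i < n.+1) f i * g (n - i)%N.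
Proof. by []. Qed.
Lemma fcoef1 n : (1 : fps R) n = (n == 0%N)%:R.
Proof. by rewrite -[LHS]/(if _ then _ else _); case: (n == _). Qed.
Lemma fcoef_sum (I : Type) (r : seq I) (P : pred I) (F : I -> fps R) n :
  (\sum_(i <- r | P i) F i) n = \sum_(i <- r | P i) F i n.
Proof.
by elim/big_rec2: _ => [|i x y _ <-]; [exact: fcoef0 | rewrite fcoefD].
Qed.

Lemma fps_const_is_additive : zmod_morphism fps_const.
Proof.
move=> a b; apply: fpsP => n; rewrite fcoefB /fps_const.
by case: (n == _); rewrite ?subr0.
Qed.
Lemma fcoefCM c f n : (fps_const c * f) n = c * f n.
Proof.
rewrite fcoefM big_ord_recl /= subn0 {1}/fps_const /= big1 ?addr0 // => i _.
by rewrite /fps_const mul0r.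
Qed.
Lemma fps_const_is_multiplicative : monoid_morphism fps_const.
Proof.
split=> // a b; apply: fpsP => n; rewrite fcoefCM /fps_const.
by case: (n == _); rewrite ?mulr0.
Qed.
HB.instance Definition _ := GRing.isZmodMorphism.Build R (fps R) fps_const
  fps_const_is_additive.
HB.instance Definition _ := GRing.isMonoidMorphism.Build R (fps R) fps_const
  fps_const_is_multiplicative.

Definition fX : fps R := fun n => (n == 1%N)%:R.

Lemma fcoefXM f n : (fX * f) n = if n is m.+1 then f m else 0.
Proof.
rewrite fcoefM; case: n => [|n]; first by rewrite big_ord1 mul0r.
rewrite big_ord_recl mul0r add0r big_ord_recl /= /bump /= mul1r subSS subn0.
by rewrite big1 ?addr0 // => i _; rewrite /fX /bump /= mul0r.
Qed.

Lemma fcoefXnM f d n : (fX ^+ d * f) n = if (d <= n)%N then f (n - d)%N else 0.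
Proof.
elim: d n => [|d IH] n; first by rewrite mul1r subn0.
by rewrite exprS -mulrA fcoefXM; case: n => //= n; rewrite IH subSS ltnS.
Qed.

Lemma fcoefXn d n : (fX ^+ d) n = (n == d)%:R.
Proof.
rewrite -[fX ^+ d]mulr1 fcoefXnM fcoef1 subn_eq0 eqn_leq andbC.
by case: (d <= n)%N.
Qed.

(** Divisibility by x^d; congruences modulo x^d are written [dvdX d (f - g)], and equalities of
    series are proved as congruences for all [d]. *)
Definition dvdX d f := forall n, (n < d)%N -> f n = 0.

Lemma dvdX0 f : dvdX 0 f. Proof. by []. Qed.
Lemma dvdX_zero d : dvdX d 0. Proof. by move=> n _; exact: fcoef0. Qed.
Lemma dvdXW d e f : (e <= d)%N -> dvdX d f -> dvdX e f.
Proof. by move=> ed Hf n ne; apply: Hf; apply: leq_trans ed. Qed.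
Lemma dvdXD d f g : dvdX d f -> dvdX d g -> dvdX d (f + g).
Proof. by move=> Hf Hg n nd; rewrite fcoefD Hf ?Hg ?addr0. Qed.
Lemma dvdXN d f : dvdX d f -> dvdX d (- f).
Proof. by move=> Hf n nd; rewrite fcoefN Hf ?oppr0. Qed.
Lemma dvdXB d f g : dvdX d f -> dvdX d g -> dvdX d (f - g).
Proof. by move=> Hf Hg; apply: dvdXD => //; apply: dvdXN. Qed.
Lemma dvdXM d e f g : dvdX d f -> dvdX e g -> dvdX (d + e) (f * g).
Proof.
move=> Hf Hg n nd; rewrite fcoefM big1 // => i _.
case: (ltnP i d) => id; first by rewrite Hf ?mul0r.
by rewrite Hg ?mulr0 //; have := ltn_ord i; lia.
Qed.
Lemma dvdXMl d f g : dvdX d g -> dvdX d (f * g).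
Proof. by move=> Hg; apply: (@dvdXM 0). Qed.
Lemma dvdXMr d f g : dvdX d f -> dvdX d (f * g).
Proof. by move=> Hf; rewrite mulrC; apply: dvdXMl. Qed.
Lemma dvdXX d f n : dvdX d f -> dvdX (d * n) (f ^+ n).
Proof.
move=> Hf; elim: n => [|n IH]; first by rewrite muln0.
by rewrite mulnS exprS; apply: dvdXM.
Qed.
Lemma dvdX_sum d (I : Type) (r : seq I) (P : pred I) (F : I -> fps R) :
  (forall i, P i -> dvdX d (F i)) -> dvdX d (\sum_(i <- r | P i) F i).
Proof.
by move=> H; elim/big_ind: _ => // [|f g]; [exact: dvdX_zero | exact: dvdXD].
Qed.
Lemma dvdX_all f : (forall d, dvdX d f) -> f = 0.
Proof. by move=> H; apply: fpsP => n; rewrite (H n.+1) ?fcoef0. Qed.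
Lemma dvdX_Xn d : dvdX d (fX ^+ d).
Proof. by move=> n nd; rewrite fcoefXn ltn_eqF. Qed.
Lemma dvdX_fX : dvdX 1 fX. Proof. exact: (dvdX_Xn (d := 1)). Qed.

Lemma dvdXP d f : dvdX d f -> f = fX ^+ d * (fun n => f (n + d)%N : R).
Proof.
move=> Hf; apply: fpsP => n; rewrite fcoefXnM; case: leqP => nd; last exact: Hf.
by rewrite subnK.
Qed.

Lemma dvdX_XnMK d e f : dvdX (d + e) (fX ^+ d * f) -> dvdX e f.
Proof.
move=> H n ne; have := H (d + n)%N; rewrite ltn_add2l => /(_ ne).
by rewrite fcoefXnM leq_addr addKn.
Qed.

Lemma dvdXB_coef d f g : dvdX d (f - g) -> forall n, (n < d)%N -> f n = g n.
Proof. by move=> H n /H /eqP; rewrite fcoefB subr_eq0 => /eqP. Qed.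

Lemma eq_mod_dvdX f g : (forall d, dvdX d (f - g)) -> f = g.
Proof. by move=> H; apply/eqP; rewrite -subr_eq0; apply/eqP/dvdX_all. Qed.

Lemma dvdX_subr_trans d g f h : dvdX d (f - g) -> dvdX d (g - h) -> dvdX d (f - h).
Proof. by move=> H1 H2; rewrite -(subrKA g); apply: dvdXD. Qed.
Lemma dvdX_subrC d f g : dvdX d (f - g) -> dvdX d (g - f).
Proof. by move=> H; rewrite -opprB; apply: dvdXN. Qed.
Lemma dvdX_congM d f f' g g' :
  dvdX d (f - f') -> dvdX d (g - g') -> dvdX d (f * g - f' * g').
Proof.
move=> H1 H2; have -> : f * g - f' * g' = (f - f') * g + f' * (g - g') by ring.
by apply: dvdXD; [apply: dvdXMr | apply: dvdXMl].
Qed.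
Lemma dvdX_congX d f f' n : dvdX d (f - f') -> dvdX d (f ^+ n - f' ^+ n).
Proof.
move=> H; elim: n => [|n IH]; first by rewrite subrr; exact: dvdX_zero.
by rewrite !exprS; apply: dvdX_congM.
Qed.

End FpsRing.

(** * Substitution, composition and first-order Taylor expansion *)

Section Substitution.
Variable R : comNzRingType.
Implicit Types (f g a b : fps R) (A B : nat -> fps R).

(* sum_i A_i b^i; junk unless b has no constant term. *)
Definition evS A b : fps R := fun N => (\sum_(i < N.+1) A i * b ^+ i) N.

(** As [b ^+ i] has order at least [i], a single partial sum serves for all coefficients below [d],
    although [evS] uses a different one for each coefficient. *)
Lemma evS_trunc A b d M : dvdX 1 b -> (d <= M)%N ->
  dvdX d (evS A b - \sum_(i < M) A i * b ^+ i).
Proof.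
move=> hb dM n nd; have nM := leq_trans nd dM.
rewrite fcoefB /evS -!(big_mkord xpredT (fun i => A i * b ^+ i)).
rewrite [X in _ - X n](big_cat_nat (leq0n n.+1) nM) /= fcoefD opprD addrA subrr add0r.
rewrite big_nat_cond (dvdX_sum (d := n.+1)) ?oppr0 // => i /andP[/andP[ni _] _].
apply: dvdXW ni _; apply: dvdXMl; rewrite -[X in dvdX X]mul1n; exact: dvdXX.
Qed.

Lemma evS_recl A b : dvdX 1 b -> evS A b = A 0%N + b * evS (fun i => A i.+1) b.
Proof.
move=> hb; apply: eq_mod_dvdX => d.
apply: dvdX_subr_trans (evS_trunc A hb (leqnSn d)) _.
rewrite big_ord_recl expr0 mulr1 opprD addrACA subrr add0r.
have -> : \sum_(i < d) A (lift ord0 i) * b ^+ lift ord0 i =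
          b * \sum_(i < d) A i.+1 * b ^+ i.
  by rewrite big_distrr /=; apply: eq_bigr => i _; rewrite /bump /= exprS mulrCA.
rewrite -mulrBr; apply: dvdXMl; apply: dvdX_subrC.
exact: evS_trunc.
Qed.

Lemma evS_split A b n : dvdX 1 b ->
  evS A b = \sum_(i < n) A i * b ^+ i + b ^+ n * evS (fun i => A (n + i)%N) b.
Proof.
move=> hb; elim: n => [|n IH]; first by rewrite big_ord0 add0r mul1r.
rewrite {}IH big_ord_recr /= -addrA; congr (_ + _).
rewrite evS_recl // addn0 mulrDr mulrC; congr (_ + _).
rewrite mulrA -exprSr; congr (_ * evS _ _).
by apply: boolp.funext => i; rewrite addSnnS.
Qed.

Lemma evS_split0 A b n : dvdX 1 b -> (forall i, (i < n)%N -> A i = 0) ->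
  evS A b = b ^+ n * evS (fun i => A (n + i)%N) b.
Proof.
move=> hb A0; rewrite (evS_split A n) // big1 ?add0r // => i _.
by rewrite A0 ?mul0r.
Qed.

Lemma evS_cong A B a b d : dvdX 1 a -> dvdX 1 b ->
  (forall i, dvdX d (A i - B i)) -> dvdX d (a - b) ->
  dvdX d (evS A a - evS B b).
Proof.
move=> ha hb hA hab.
apply: dvdX_subr_trans (evS_trunc A ha (leqnn d)) _.
apply: dvdX_subr_trans (dvdX_subrC (evS_trunc B hb (leqnn d))).
rewrite -sumrB; apply: dvdX_sum => i _; apply: dvdX_congM => //.
exact: dvdX_congX.
Qed.

Lemma evSB A B b : evS (fun i => A i - B i) b = evS A b - evS B b.
Proof.
apply: fpsP => n; rewrite /evS fcoefB -fcoefB -sumrB; congr (_ n).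
by apply: eq_bigr => i _; rewrite mulrBl.
Qed.

Lemma evS_coef0 A b : dvdX 1 b -> evS A b 0%N = A 0%N 0%N.
Proof. by move=> hb; rewrite /evS big_ord1 mulr1. Qed.

Lemma evS0 A : evS A 0 = A 0%N.
Proof. by rewrite evS_recl ?mul0r ?addr0 //; apply: dvdX_zero. Qed.

(** Composition is [evS] with constant coefficients, so that sum_i P_i(x) y^i and chi(y) can be
    compared term by term. *)
Definition fcomp f a := evS (fun i => fps_const (f i)) a.

Lemma evS_const f a : evS (fun i => fps_const (f i)) a = fcomp f a.
Proof. by []. Qed.

Lemma fcomp_trunc f a d M : dvdX 1 a -> (d <= M)%N ->
  dvdX d (fcomp f a - \sum_(i < M) fps_const (f i) * a ^+ i).
Proof. exact: evS_trunc. Qed.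

Lemma fcomp_recl f a : dvdX 1 a ->
  fcomp f a = fps_const (f 0%N) + a * fcomp (fun n => f n.+1) a.
Proof. exact: evS_recl. Qed.

Lemma fcomp_shift f a n : dvdX 1 a -> dvdX n f ->
  fcomp f a = a ^+ n * fcomp (fun i => f (n + i)%N) a.
Proof. by move=> ha hf; apply: evS_split0 => // i /hf->; rewrite rmorph0. Qed.

Lemma fcomp_coef0 f a : dvdX 1 a -> fcomp f a 0%N = f 0%N.
Proof. by move=> ha; rewrite /fcomp evS_coef0. Qed.

Lemma fcomp_cong f a b d : dvdX 1 a -> dvdX 1 b -> dvdX d (a - b) ->
  dvdX d (fcomp f a - fcomp f b).
Proof.
move=> ha hb hab; apply: evS_cong => // i; rewrite subrr; exact: dvdX_zero.
Qed.

Lemma dvdX_comp d e f a : dvdX 1 a -> dvdX d f -> dvdX e a ->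
  dvdX (e * d) (fcomp f a).
Proof.
move=> ha hf he; rewrite (fcomp_shift ha hf); apply: dvdXMr; exact: dvdXX.
Qed.

Lemma dvdX1_comp f a : dvdX 1 f -> dvdX 1 a -> dvdX 1 (fcomp f a).
Proof. by move=> hf ha; apply: (dvdX_comp (d := 1) (e := 1)). Qed.

Lemma fcompB f g a : fcomp (f - g) a = fcomp f a - fcomp g a.
Proof.
rewrite -evSB; congr (evS _ a); apply: boolp.funext => i.
by rewrite fcoefB rmorphB.
Qed.

Lemma fcomp_const c a : dvdX 1 a -> fcomp (fps_const c) a = fps_const c.
Proof.
move=> ha; apply: eq_mod_dvdX => d.
apply: dvdX_subr_trans (fcomp_trunc (fps_const c) ha (leqnSn d)) _.
rewrite big_ord_recl mulr1 addrAC subrr add0r big1 => [|i _].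
  exact: dvdX_zero.
by rewrite [X in fps_const X](_ : _ = 0) // rmorph0 mul0r.
Qed.

Lemma fcomp_Xn n a : dvdX 1 a -> fcomp (fX R ^+ n) a = a ^+ n.
Proof.
move=> ha; rewrite (fcomp_shift ha (@dvdX_Xn R n)).
have -> : (fun i => (fX R ^+ n) (n + i)%N) = fps_const 1.
  apply: fpsP => i; rewrite fcoefXn /fps_const -{2}[n]addn0 eqn_add2l.
  by case: (i == _).
by rewrite fcomp_const // mulr1.
Qed.

Lemma fcomp_fX a : dvdX 1 a -> fcomp (fX R) a = a.
Proof. exact: (fcomp_Xn 1). Qed.

Lemma fcomp_Xr f : fcomp f (fX R) = f.
Proof.
apply: fpsP => n; rewrite /fcomp /evS fcoef_sum (bigD1 ord_max) //=.
rewrite fcoefCM fcoefXn eqxx mulr1 big1 ?addr0 // => i /eqP ni.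
rewrite fcoefCM fcoefXn; case: eqP => [E|]; last by rewrite mulr0.
by case: ni; apply: val_inj.
Qed.

Lemma comp0r f : fcomp f 0 = fps_const (f 0%N).
Proof. exact: evS0. Qed.

Definition fderiv f : fps R := fun n => f n.+1 *+ n.+1.

Lemma expr_taylor a b K n : dvdX K b ->
  dvdX (K + K) ((a + b) ^+ n.+1 - a ^+ n.+1 - a ^+ n * b *+ n.+1).
Proof.
move=> hb; elim: n => [|n IH].
  by rewrite !expr1 mul1r mulr1n [a + b]addrC addrK subrr; exact: dvdX_zero.
set r := _ - _ in IH.
have -> : (a + b) ^+ n.+2 - a ^+ n.+2 - a ^+ n.+1 * b *+ n.+2 =
          (a + b) * r + (a ^+ n *+ n.+1) * (b * b).
  rewrite /r (exprS (a + b) n.+1) (exprS a n.+1) (exprS a n).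
  by move: ((a + b) ^+ _) (a ^+ n) => u v; ring.
by apply: dvdXD; apply: dvdXMl => //; apply: dvdXM.
Qed.

(** The remainder is a multiple of [b ^+ 2], obtained without dividing by integers, so the expansion
    is valid in characteristic p. *)
Lemma fcomp_taylor f a b K : dvdX 1 a -> dvdX 1 b -> dvdX K b ->
  dvdX (K + K) (fcomp f (a + b) - fcomp f a - fcomp (fderiv f) a * b).
Proof.
move=> ha hb hK; set d := (K + K)%N; have hab := dvdXD ha hb.
have H1 := fcomp_trunc f hab (leqnSn d).
have H2 := fcomp_trunc f ha (leqnSn d).
have H3 := fcomp_trunc (fderiv f) ha (leqnn d).
move: H1 H2 H3; set s1 := (X in _ - X); set s2 := (X in _ -> dvdX _ (_ - X) -> _).
set s3 := (X in _ -> _ -> dvdX _ (_ - X) -> _) => H1 H2 H3.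
have -> : fcomp f (a + b) - fcomp f a - fcomp (fderiv f) a * b =
  (fcomp f (a + b) - s1) - (fcomp f a - s2) - (fcomp (fderiv f) a - s3) * b
  + (s1 - s2 - s3 * b) by ring.
apply: dvdXD; first by apply: dvdXB; [exact: dvdXB | exact: dvdXMr].
rewrite /s1 /s2 big_ord_recl [X in _ - X - _]big_ord_recl !expr0 opprD addrACA subrr add0r.
rewrite -sumrB /s3 big_distrl -sumrB /=; apply: dvdX_sum => i _.
rewrite /fderiv /bump /= add1n -mulrBr raddfMn /= -mulrA.
have -> : fps_const (f i.+1) *+ i.+1 * (a ^+ i * b) =
          fps_const (f i.+1) * (a ^+ i * b *+ i.+1) by rewrite mulrnAl mulrnAr.
by rewrite -mulrBr; apply: dvdXMl; apply: expr_taylor.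
Qed.

End Substitution.

(** * Series over a field: orders, cancellation, implicit equations *)

Section FieldSeries.
Variable k : fieldType.
Implicit Types (f g a b : fps k) (A : nat -> fps k).

Lemma dvdX_unitMK d f g : f 0%N != 0 -> dvdX d (f * g) -> dvdX d g.
Proof.
move=> f0 H n; elim/ltn_ind: n => n IH nd.
have := H n nd; rewrite fcoefM big_ord_recl subn0 big1 ?addr0.
  by move/eqP; rewrite mulf_eq0 (negPf f0) => /eqP.
by move=> i _; rewrite IH ?mulr0 //=; rewrite /bump /=; have := ltn_ord i; lia.
Qed.

Lemma fps_order f : f <> 0 -> exists2 m, dvdX m f & f m != 0.
Proof.
move=> f0; have exf : exists n, f n != 0.
  apply: boolp.contrapT => H; apply: f0; apply: fpsP => n; rewrite fcoef0.
  by apply/eqP; apply/negPn/negP => Hn; apply: H; exists n.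
have [n fn min] := ex_minnP exf.
exists n => // i ilt; apply/eqP; apply: contraLR ilt => /min; by rewrite -leqNgt.
Qed.

Lemma dvdX_mulK m d f g : dvdX m f -> f m != 0 -> dvdX (m + d) (f * g) -> dvdX d g.
Proof.
move=> hm fm; rewrite {1}(dvdXP hm) -mulrA => /dvdX_XnMK.
by apply: dvdX_unitMK; rewrite add0n.
Qed.

Lemma fps_mul_eq0 f g : f <> 0 -> f * g = 0 -> g = 0.
Proof.
move=> /fps_order[m hm fm] fg; apply: dvdX_all => d.
by apply: (dvdX_mulK hm fm); rewrite fg; exact: dvdX_zero.
Qed.

Lemma fps_exp_neq0 f n : f <> 0 -> f ^+ n <> 0.
Proof.
move=> f0; elim: n => [|n IH]; first by apply/eqP; rewrite oner_eq0.
by rewrite exprS => /(fps_mul_eq0 f0).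
Qed.

(** If f has order m, then f(a) is [a ^+ m] times a series with nonzero constant term, and the
    latter cannot vanish. *)
Lemma fcomp_eq0 f a : f <> 0 -> dvdX 1 a -> fcomp f a = 0 -> a = 0.
Proof.
move=> /fps_order[m hm fm] ha; rewrite (fcomp_shift ha hm) => H.
apply: boolp.contrapT => /(@fps_exp_neq0 _ m)/fps_mul_eq0/(_ H).
move/(congr1 (fun f => f 0%N)); rewrite fcomp_coef0 // addn0 fcoef0.
by move/eqP; rewrite (negPf fm).
Qed.

(** Newton iteration with the slope frozen at [A 1%N 0%N]: each application of [Phi] gains one order
    of agreement. Inverses for G and inverses under composition both come from here. *)
Lemma fps_hensel A : A 0%N 0%N = 0 -> A 1%N 0%N != 0 ->
  exists2 b, dvdX 1 b & evS A b = 0.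
Proof.
move=> A0 A1; pose c := A 1%N 0%N; pose Phi b := b - fps_const c^-1 * evS A b.
have PhiX b : dvdX 1 b -> dvdX 1 (Phi b).
  move=> hb; apply: dvdXB => //; apply: dvdXMl => -[|//] _.
  by rewrite evS_coef0.
have Phi_contr b b' N : dvdX 1 b -> dvdX 1 b' -> (0 < N)%N -> dvdX N (b - b') ->
    dvdX N.+1 (Phi b - Phi b').
  move=> hb hb' N0 H; rewrite /Phi (evS_split A 2 hb) (evS_split A 2 hb').
  rewrite !big_ord_recr !big_ord0 /= !expr1 !expr0.
  set E := evS _ b; set E' := evS _ b'.
  have Ac : dvdX 1 (1 - fps_const c^-1 * A 1%N).
    by move=> [|//] _; rewrite fcoefB fcoef1 fcoefCM mulVf // subrr.
  have -> : b - fps_const c^-1 * (0 + A 0%N * 1 + A 1%N * b + b ^+ 2 * E) -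
       (b' - fps_const c^-1 * (0 + A 0%N * 1 + A 1%N * b' + b' ^+ 2 * E')) =
    (1 - fps_const c^-1 * A 1%N) * (b - b') - fps_const c^-1 *
    ((b - b') * ((b + b') * E) + (b' * b') * (E - E')) by ring.
  have HE : dvdX N (E - E').
    by apply: evS_cong => // i; rewrite subrr; exact: dvdX_zero.
  apply: dvdXB; first by rewrite -add1n; exact: dvdXM.
  apply: dvdXMl; apply: dvdXD.
    by rewrite -addn1; apply: dvdXM => //; apply: dvdXMr; apply: dvdXD.
  by rewrite -add1n; apply: dvdXM => //; apply: dvdXMr.
pose s n := iter n Phi 0.
have sX n : dvdX 1 (s n) by elim: n => [|n /PhiX//]; exact: dvdX_zero.
have sS n : dvdX n.+1 (s n.+1 - s n).
  elim: n => [|n IH]; first by apply: dvdXB.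
  exact: (Phi_contr (s n.+1) (s n) n.+1).
have sD n m : dvdX n.+1 (s (n + m)%N - s n).
  elim: m => [|m IH]; first by rewrite addn0 subrr; exact: dvdX_zero.
  rewrite addnS; apply: dvdX_subr_trans IH.
  by apply: dvdXW (sS _); rewrite ltnS leq_addr.
(* Coefficient [n] no longer changes from the iterate [s n] on, so the diagonal is the limit. *)
pose b : fps k := fun n => s n n.
have bs n : dvdX n.+1 (b - s n).
  move=> m; rewrite ltnS => mn; rewrite fcoefB /b -(subnKC mn).
  by rewrite -(dvdXB_coef (sD m (n - m)%N)) ?subrr.
have hb : dvdX 1 b by move=> [|//] _; rewrite /b; exact: fcoefC0.
exists b => //.
suff /eqP : Phi b = b.
  rewrite /Phi eq_sym addrC -subr_eq subrr eq_sym oppr_eq0 => /eqP H.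
  have -> : evS A b = fps_const c * (fps_const c^-1 * evS A b).
    by rewrite mulrA -rmorphM mulfV // rmorph1 mul1r.
  by rewrite H mulr0.
apply: eq_mod_dvdX => d; apply: (@dvdX_subr_trans _ _ (s d.+1)).
  have := Phi_contr b (s d) d.+1 hb (sX d) isT (bs d).
  by apply: dvdXW; lia.
by apply: dvdX_subrC; apply: dvdXW (bs _); lia.
Qed.

End FieldSeries.

(** * Polynomial substitution and filtrations *)

Section Filtration.
Variables (R T : comNzRingType) (phi : {rmorphism R -> T}).
Variable Fil : nat -> T -> Prop.
Hypothesis Fil_all : forall x, Fil 0 x.
Hypothesis Fil_zero : forall d, Fil d 0.
Hypothesis FilD : forall d x y, Fil d x -> Fil d y -> Fil d (x + y).
Hypothesis FilM : forall d e x y, Fil d x -> Fil e y -> Fil (d + e) (x * y).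
Hypothesis FilW : forall d e x, (e <= d)%N -> Fil d x -> Fil e x.

(** The filtration is abstract because the estimate is used twice: for total degree in [{mpoly
    R[n]}] ([mord]) and for the x-adic order in [fps R] ([dvdX]). *)
Lemma filtration_mmap n d (a : 'I_n -> T) (P : {mpoly R[n]}) :
  (forall i, Fil 1 (a i)) -> (forall m, (mdeg m < d)%N -> P@_m = 0) ->
  Fil d (mmap phi a P).
Proof.
move=> ha hP; rewrite /mmap big_seq_cond; elim/big_ind: _ => // [x y|m].
  exact: FilD.
rewrite andbT mcoeff_msupp => Pm; rewrite -[d]add0n; apply: FilM => //.
apply: FilW (_ : Fil (mdeg m) _).
  by rewrite leqNgt; apply/negP => /hP/eqP; apply/negP.
rewrite mdegE /mmap1.
elim/big_rec2: _ => // i e x _ He; apply: FilM => //.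
elim: (m i) => [|l IH] //; rewrite exprS -add1n; exact: FilM.
Qed.

Lemma filtration_mmap_cong n d (a b : 'I_n -> T) (P : {mpoly R[n]}) :
  (forall i, Fil d (a i - b i)) -> Fil d (mmap phi a P - mmap phi b P).
Proof.
have congM x x' y y' : Fil d (x - x') -> Fil d (y - y') -> Fil d (x * y - x' * y').
  move=> H1 H2; have -> : x * y - x' * y' = (x - x') * y + x' * (y - y') by ring.
  apply: FilD; first by rewrite -[d]addn0; apply: FilM.
  by rewrite -[d]add0n; apply: FilM.
move=> hab; rewrite /mmap -sumrB; elim/big_ind: _ => // [x y|m _].
  exact: FilD.
apply: (congM); first by rewrite subrr.
rewrite /mmap1; elim/big_rec2: _ => [|i x y _ H]; first by rewrite subrr.
apply: (congM) => //; elim: (m i) => [|l IH]; first by rewrite subrr.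
by rewrite !exprS; apply: (congM).
Qed.

End Filtration.

Lemma mmap_comp_mpoly (R T : comNzRingType) (phi : {rmorphism R -> T}) m n
    (a : 'I_n -> T) (P : {mpoly R[m]}) (Q : m.-tuple {mpoly R[n]}) :
  mmap phi a (P \mPo Q) = mmap phi (fun i => mmap phi a (tnth Q i)) P.
Proof.
rewrite comp_mpolyE raddf_sum /= [in RHS]/mmap; apply: eq_bigr => e _.
rewrite mmapZ /= rmorph_prod /=; congr (_ * _); apply: eq_bigr => i _.
by rewrite rmorphXn.
Qed.

(** * Evaluation of series in several variables at points of the ideal x R[[x]] *)

Section Evaluation.
Variable R : comNzRingType.

Definition mord n d (P : {mpoly R[n]}) := forall m, (mdeg m < d)%N -> P@_m = 0.

Lemma mordM n d e (P Q : {mpoly R[n]}) : mord d P -> mord e Q -> mord (d + e) (P * Q).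
Proof.
move=> hP hQ m md; rewrite mcoeffM big1 // => -[i j] /= /eqP /(congr1 (fun m => mdeg m)) E.
case: (ltnP (mdeg i) d) => id; first by rewrite hP ?mul0r.
by rewrite hQ ?mulr0 //; move: md E; rewrite mdegD; lia.
Qed.
Lemma mordD n d (P Q : {mpoly R[n]}) : mord d P -> mord d Q -> mord d (P + Q).
Proof. by move=> hP hQ m md; rewrite mcoeffD hP ?hQ ?addr0. Qed.
Lemma mord0 n d : mord d (0 : {mpoly R[n]}).
Proof. by move=> m _; rewrite mcoeff0. Qed.
Lemma mordW n d e (P : {mpoly R[n]}) : (e <= d)%N -> mord d P -> mord e P.
Proof. by move=> ed hP m me; apply: hP; apply: leq_trans ed. Qed.

Lemma strunc_coeff n d (f : series R n) m :
  (strunc d f)@_m = if (mdeg m < d)%N then f m else 0.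
Proof.
rewrite /strunc raddf_sum /=; case: ltnP => md.
  rewrite (bigD1 (BMultinom md)) //= mcoeffZ mcoeffX eqxx mulr1 big1 ?addr0 //.
  move=> i ni; rewrite mcoeffZ mcoeffX; case: eqP => [E|]; last by rewrite mulr0.
  by case/eqP: ni; apply: val_inj.
rewrite big1 // => i _; rewrite mcoeffZ mcoeffX; case: eqP => [E|]; last by rewrite mulr0.
by have := bmdeg i; rewrite E; lia.
Qed.

(** Raising the truncation changes only terms of degree above that of [e]; the [g i] and then [f]
    are replaced in turn. Hence one [d] serves for all exponents of degree below [d], as [ev_ssubst]
    requires. *)
Lemma ssubst_coeff m n (f : series R m) (g : 'I_m -> series R n) d e :
  (forall i, no_constant_term (g i)) -> (mdeg e < d)%N ->
  ssubst f g e = (strunc d f \mPo [tuple strunc d (g i) | i < m])@_e.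
Proof.
move=> hg ed; rewrite /ssubst; set D := (mdeg e).+1.
have Hg i c : mord 1 (strunc c (g i)).
  move=> l; rewrite ltnS leqn0 mdeg_eq0 => /eqP ->.
  by rewrite strunc_coeff hg if_same.

suff H : mord D ((strunc D f \mPo [tuple strunc D (g i) | i < m]) -
                 (strunc d f \mPo [tuple strunc d (g i) | i < m])).
  by apply/eqP; rewrite -subr_eq0 -mcoeffB H.
have mM := @mordM n; have mD := @mordD n; have m0 := @mord0 n; have mW := @mordW n.
rewrite -(subrKA (strunc D f \mPo [tuple strunc d (g i) | i < m])) /comp_mpoly.
apply: mordD.
  apply: (@filtration_mmap_cong _ _ (@mpolyC n R) (@mord n)) => // i l lD.
  rewrite !tnth_mktuple mcoeffB !strunc_coeff lD (leq_trans lD ed) subrr //.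
rewrite -raddfB; apply: (@filtration_mmap _ _ (@mpolyC n R) (@mord n)) => // [i|l lD].
  by rewrite tnth_mktuple.
by rewrite mcoeffB !strunc_coeff lD (leq_trans lD ed) subrr.
Qed.

(* Junk unless the series a i have no constant term. *)
Definition ev n (f : series R n) (a : 'I_n -> fps R) : fps R :=
  fun N => mmap (@fps_const R) a (strunc N.+1 f) N.

Lemma dvdX_mmap n d (a : 'I_n -> fps R) (P : {mpoly R[n]}) :
  (forall i, dvdX 1 (a i)) -> mord d P -> dvdX d (mmap (@fps_const R) a P).
Proof.
move=> ha hP; apply: (@filtration_mmap _ _ _ (@dvdX R)) => //; first exact: dvdX_zero.
- exact: dvdXD.
- exact: dvdXM.
- exact: dvdXW.
Qed.

Lemma dvdX_mmap_cong n d (a b : 'I_n -> fps R) (P : {mpoly R[n]}) :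
  (forall i, dvdX d (a i - b i)) ->
  dvdX d (mmap (@fps_const R) a P - mmap (@fps_const R) b P).
Proof.
move=> hab; apply: (@filtration_mmap_cong _ _ _ (@dvdX R)) => //; first exact: dvdX_zero.
- exact: dvdXD.
- exact: dvdXM.
Qed.

Lemma ev_approx n d (f : series R n) a (P : {mpoly R[n]}) :
  (forall i, dvdX 1 (a i)) -> (forall m, (mdeg m < d)%N -> P@_m = f m) ->
  dvdX d (ev f a - mmap (@fps_const R) a P).
Proof.
move=> ha hP N Nd; rewrite fcoefB /ev -fcoefB -raddfB.
apply: (dvdX_mmap (d := N.+1)) => // m mN.
by rewrite mcoeffB strunc_coeff mN hP ?subrr //; apply: leq_trans Nd.
Qed.

Lemma ev_strunc n d (f : series R n) a : (forall i, dvdX 1 (a i)) ->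
  dvdX d (ev f a - mmap (@fps_const R) a (strunc d f)).
Proof.
by move=> ha; apply: ev_approx => // m md; rewrite strunc_coeff md.
Qed.

Lemma dvdX_ev n (f : series R n) a : (forall i, dvdX 1 (a i)) ->
  no_constant_term f -> dvdX 1 (ev f a).
Proof.
move=> ha f0; have := ev_approx (d := 1) (f := f) (P := 0) ha.
rewrite mmap0 subr0; apply => m; rewrite ltnS leqn0 mdeg_eq0 => /eqP ->.
by rewrite mcoeff0 f0.
Qed.

Lemma ev_ssubst m n (f : series R m) (g : 'I_m -> series R n) a :
  (forall i, no_constant_term (g i)) -> (forall i, dvdX 1 (a i)) ->
  ev (ssubst f g) a = ev f (fun i => ev (g i) a).
Proof.
move=> hg ha; apply: eq_mod_dvdX => d.
pose Q := [tuple strunc d (g i) | i < m].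
apply: (@dvdX_subr_trans _ _ (mmap (@fps_const R) a (strunc d f \mPo Q))).
  by apply: ev_approx => // l ld; rewrite (ssubst_coeff _ hg ld).
rewrite mmap_comp_mpoly.
apply: (@dvdX_subr_trans _ _
  (mmap (@fps_const R) (fun i => ev (g i) a) (strunc d f))).
  apply: dvdX_mmap_cong => i; rewrite tnth_mktuple; apply: dvdX_subrC.
  exact: ev_strunc.
by apply: dvdX_subrC; apply: ev_strunc => i; apply: dvdX_ev.
Qed.

Lemma eq_ev n (f : series R n) a b : a =1 b -> ev f a = ev f b.
Proof. by move=> /boolp.funext ->. Qed.

Lemma ev_svar n (i : 'I_n) a : (forall i, dvdX 1 (a i)) -> ev (svar i) a = a i.
Proof.
move=> ha; apply: eq_mod_dvdX => d.
have := ev_approx (d := d) (f := svar i) (P := 'X_i) ha.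
rewrite mmapX mmap1U; apply => m _; rewrite mcoeffX /svar eq_sym; by case: eqP.
Qed.

Lemma ev_szero n a : (forall i, dvdX 1 (a i)) -> ev (szero : series R n) a = 0.
Proof.
move=> ha; apply: eq_mod_dvdX => d.
have := ev_approx (d := d) (f := szero) (P := 0) ha.
by rewrite mmap0; apply => m _; rewrite mcoeff0.
Qed.

Definition toF (f : series R 1) : fps R := fun n => f [multinom n | _ < 1].
Definition ofF (f : fps R) : series R 1 := fun e => f (mdeg e).

Lemma mdeg_multinom1 n : mdeg [multinom n | _ < 1] = n.
Proof. by rewrite mdegE big_ord1 mnmE. Qed.

Lemma multinom1_mdeg (m : 'X_{1..1}) : [multinom mdeg m | _ < 1] = m.
Proof. by apply/mnmP => i; rewrite mnmE mdegE big_ord1 (ord1 i). Qed.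

Lemma ofFK f : toF (ofF f) = f.
Proof. by apply: fpsP => n; rewrite /toF /ofF mdeg_multinom1. Qed.

Lemma toFK f : ofF (toF f) = f.
Proof. by apply: boolp.funext => m; rewrite /toF /ofF multinom1_mdeg. Qed.

Lemma dvdX_toF f : no_constant_term f <-> dvdX 1 (toF f).
Proof.
have E : [multinom 0%N | _ < 1] = 0%MM by apply/mnmP => i; rewrite !mnmE.
split=> [H [|//] _|/(_ 0%N isT)]; rewrite /toF E //.
Qed.

Lemma ev1E (f : series R 1) a : dvdX 1 (a ord0) -> ev f a = fcomp (toF f) (a ord0).
Proof.
move=> ha; have ha' i : dvdX 1 (a i) by rewrite ord1.
apply: eq_mod_dvdX => d.
apply: dvdX_subr_trans (dvdX_subrC (fcomp_trunc _ ha (leqnn d))).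
pose P : {mpoly R[1]} := \sum_(i < d) (toF f i) *: 'X_[[multinom i : nat | _ < 1]].
have -> : \sum_(i < d) fps_const (toF f i) * a ord0 ^+ i = mmap (@fps_const R) a P.
  rewrite /P raddf_sum; apply: eq_bigr => i _.
  by rewrite /= mmapZ mmapX /mmap1 big_ord1 mnmE.
apply: ev_approx => // m md; rewrite /P raddf_sum (bigD1 (Ordinal md)) //=.
rewrite mcoeffZ mcoeffX multinom1_mdeg eqxx mulr1 /toF multinom1_mdeg big1 ?addr0 //.
move=> i ni; rewrite mcoeffZ mcoeffX; case: eqP => [E|]; last by rewrite mulr0.
by case/eqP: ni; apply: val_inj; rewrite /= -E mdeg_multinom1.
Qed.

Definition mnm2 (j i : nat) : 'X_{1..2} := [multinom if l == ord0 then j else i | l < 2].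
(** [F] is regarded as an element of R[[x]][[y]], the form that [evS] evaluates. *)
Definition ycoef (F : series R 2) (i : nat) : fps R := fun j => F (mnm2 j i).
Definition pt2 (a b : fps R) (i : 'I_2) : fps R := if i == ord0 then a else b.

Lemma mdeg_mnm2 j i : mdeg (mnm2 j i) = (j + i)%N.
Proof. by rewrite mdegE !big_ord_recl big_ord0 !mnmE addn0. Qed.

Lemma mnm2_eta (m : 'X_{1..2}) : mnm2 (m ord0) (m (inord 1)) = m.
Proof.
apply/mnmP => i; rewrite mnmE; case: eqP => [->//|ni]; congr (m _).
apply: val_inj; rewrite /= inordK //; have := ltn_ord i.
have : nat_of_ord i <> 0%N by move=> i0; apply: ni; apply: val_inj.
by lia.
Qed.

Lemma dvdX_pt2 a b i : dvdX 1 a -> dvdX 1 b -> dvdX 1 (pt2 a b i).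
Proof. by rewrite /pt2; case: ifP. Qed.

Lemma ev2E (F : series R 2) a b : dvdX 1 a -> dvdX 1 b ->
  ev F (pt2 a b) = evS (fun i => fcomp (ycoef F i) a) b.
Proof.
move=> ha hb; have hab i : dvdX 1 (pt2 a b i) by exact: dvdX_pt2.
apply: eq_mod_dvdX => d.
apply: dvdX_subr_trans (dvdX_subrC (evS_trunc _ hb (leqnn d))).
pose P : {mpoly R[2]} := \sum_(i < d) \sum_(j < d) (ycoef F i j) *: 'X_[mnm2 j i].
apply: (@dvdX_subr_trans _ _ (mmap (@fps_const R) (pt2 a b) P)).
  apply: ev_approx => // m md.
  have [m0 m1] : (m ord0 < d)%N /\ (m (inord 1) < d)%N.
    by move: md; rewrite -{1}(mnm2_eta m) mdeg_mnm2; lia.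
  rewrite /P raddf_sum (bigD1 (Ordinal m1)) //= raddf_sum (bigD1 (Ordinal m0)) //=.
  rewrite /ycoef mnm2_eta mcoeffZ mcoeffX eqxx mulr1 big1 => [|j nj].
    rewrite addr0 big1 ?addr0 // => i ni; rewrite raddf_sum big1 // => j _ /=.
    rewrite mcoeffZ mcoeffX; case: eqP => [E|]; last by rewrite mulr0.
    case/eqP: ni; apply: val_inj; rewrite /= -E mnmE ifF //.
    by apply/eqP => /(congr1 val) /=; rewrite inordK.
  rewrite mcoeffZ mcoeffX; case: eqP => [E|]; last by rewrite mulr0.
  by case/eqP: nj; apply: val_inj; rewrite /= -E mnmE.
rewrite /P raddf_sum -sumrB; apply: dvdX_sum => i _.
rewrite raddf_sum [X in X - _](_ : _ =
    (\sum_(j < d) fps_const (ycoef F i j) * a ^+ j) * b ^+ i); last first.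
  rewrite big_distrl; apply: eq_bigr => j _ /=.
  by rewrite mmapZ mmapX /mmap1 !big_ord_recl big_ord0 !mnmE /= mulr1 mulrA.
rewrite -mulrBl; apply: dvdXMr; apply: dvdX_subrC.
exact: fcomp_trunc.
Qed.

(** Once the coefficients below [i] are known to vanish, cancelling y^i at y = x^M leaves [A i]
    divisible by x^M, with M arbitrary. *)
Lemma evS_Xn_eq0 (A : nat -> fps R) :
  (forall M, (0 < M)%N -> evS A (fX R ^+ M) = 0) -> forall i, A i = 0.
Proof.
move=> H; elim/ltn_ind => i IH; apply: dvdX_all => d.
have hX : dvdX 1 (fX R ^+ d.+1) by apply: dvdXW (@dvdX_Xn R d.+1).
have := H d.+1 isT; rewrite (evS_split0 hX IH) evS_recl // addn0 -exprM => E.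
apply: (@dvdXW _ d.+1) => //.
have : dvdX d.+1 (A i + fX R ^+ d.+1 * evS (fun j => A (i + j.+1)%N) (fX R ^+ d.+1)).
  by apply: (dvdX_XnMK (d := (d.+1 * i)%N)); rewrite E; exact: dvdX_zero.
have hr := dvdXMr (evS (fun j => A (i + j.+1)%N) (fX R ^+ d.+1)) (@dvdX_Xn R d.+1).
by move/dvdXB => /(_ _ hr); rewrite addrK.
Qed.

(** This is the way back from identities between points to identities in R[[x, y]]. *)
Lemma series2_ext (F H : series R 2) :
  (forall M, (0 < M)%N ->
     ev F (pt2 (fX R) (fX R ^+ M)) = ev H (pt2 (fX R) (fX R ^+ M))) -> F = H.
Proof.
move=> E; have E' i : ycoef F i - ycoef H i = 0.
  apply: (@evS_Xn_eq0 (fun i => ycoef F i - ycoef H i)) => M M0.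
  have hM : dvdX 1 (fX R ^+ M) by apply: dvdXW (@dvdX_Xn R M).
  rewrite evSB; apply/eqP; rewrite subr_eq0; apply/eqP.
  have := E M M0; rewrite !ev2E //; try exact: dvdX_fX.
  have Er (F' : series R 2) : (fun i => fcomp (ycoef F' i) (fX R)) = ycoef F'.
    by apply: boolp.funext => j; exact: fcomp_Xr.
  by rewrite !Er.
apply: boolp.funext => m; rewrite -(mnm2_eta m).
have /(congr1 (fun f => f (m ord0)))/eqP := E' (m (inord 1)).
by rewrite fcoefB fcoef0 subr_eq0 => /eqP.
Qed.

End Evaluation.

(** * Composition of one-variable series and its inverse *)

Section Composition.
Variable R : comNzRingType.
Implicit Types (f g a b : fps R).

Lemma toF_ev (f : series R 1) : toF f = ev f (fun _ => fX R).
Proof. by rewrite ev1E ?fcomp_Xr //; exact: dvdX_fX. Qed.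

Lemma toF_inj : injective (@toF R).
Proof. exact: can_inj (@toFK R). Qed.

Lemma toF_svar : toF sX = fX R.
Proof. by rewrite toF_ev ev_svar // => _; exact: dvdX_fX. Qed.

Lemma dvdX_ofF f : dvdX 1 f -> no_constant_term (ofF f).
Proof. by move=> hf; apply/dvdX_toF; rewrite ofFK. Qed.

Lemma no_constant_svar n (i : 'I_n) : no_constant_term (svar i : series R n).
Proof.
rewrite /no_constant_term /svar; case: eqP => // /(congr1 (fun m => mdeg m)).
by rewrite mdeg0 mdeg1.
Qed.

Lemma no_constant_ssubst m n (f : series R m) (g : 'I_m -> series R n) :
  no_constant_term f -> (forall i, no_constant_term (g i)) ->
  no_constant_term (ssubst f g).
Proof.
move=> f0 g0; rewrite /no_constant_term /ssubst mdeg0.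
have -> : strunc 1 f = 0.
  apply/mpolyP => e; rewrite strunc_coeff mcoeff0 ltnS leqn0 mdeg_eq0.
  by case: eqP => // ->.
by rewrite comp_mpoly0 mcoeff0.
Qed.

Lemma ev_ssubst2 n (F : series R 2) (f g : series R n)
    (a : 'I_n -> fps R) :
  no_constant_term f -> no_constant_term g -> (forall i, dvdX 1 (a i)) ->
  ev (ssubst2 F f g) a = ev F (pt2 (ev f a) (ev g a)).
Proof.
move=> hf hg ha; rewrite ev_ssubst // => [|i]; last by rewrite /pair2; case: ifP.
by apply: eq_ev => i; rewrite /pair2 /pt2; case: ifP.
Qed.

Lemma ev_scomp n (f : series R 1) (g : series R n)
    (a : 'I_n -> fps R) :
  no_constant_term g -> (forall i, dvdX 1 (a i)) ->
  ev (scomp f g) a = fcomp (toF f) (ev g a).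
Proof. by move=> hg ha; rewrite ev_ssubst // ev1E //; exact: dvdX_ev. Qed.

Lemma toF_scomp (f g : series R 1) : no_constant_term g ->
  toF (scomp f g) = fcomp (toF f) (toF g).
Proof.
by move=> hg; rewrite !toF_ev ev_scomp // ?toF_ev // => _; exact: dvdX_fX.
Qed.

(** Associativity of composition is the compatibility of evaluation with substitution, read in one
    variable. *)
Lemma fcompA f g a : dvdX 1 g -> dvdX 1 a ->
  fcomp (fcomp f g) a = fcomp f (fcomp g a).
Proof.
move=> hg ha; rewrite -{1}[f]ofFK -{1}[g]ofFK -toF_scomp; last exact: dvdX_ofF.
have /= E := ev1E (a := fun _ => a) _ ha.
by rewrite -E ev_scomp ?E ?ofFK //; exact: dvdX_ofF.
Qed.

Lemma toF_ssubst2 (F : series R 2) (f g : series R 1) :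
  no_constant_term f -> no_constant_term g ->
  toF (ssubst2 F f g) = ev F (pt2 (toF f) (toF g)).
Proof.
by move=> hf hg; rewrite !toF_ev ev_ssubst2 // ?toF_ev // => _; exact: dvdX_fX.
Qed.

Lemma fcomp_ev2 (F : series R 2) a b c : dvdX 1 a -> dvdX 1 b -> dvdX 1 c ->
  fcomp (ev F (pt2 a b)) c = ev F (pt2 (fcomp a c) (fcomp b c)).
Proof.
move=> ha hb hc; have [ha' hb'] := (dvdX_ofF ha, dvdX_ofF hb).
rewrite -{1}[a]ofFK -{1}[b]ofFK -toF_ssubst2 //.
have /= E := ev1E (a := fun _ => c) _ hc.
by rewrite -E ev_ssubst2 // !E !ofFK.
Qed.

Lemma ev2_cong (F : series R 2) a b a' b' d :
  dvdX 1 a -> dvdX 1 b -> dvdX 1 a' -> dvdX 1 b' ->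
  dvdX d (a - a') -> dvdX d (b - b') ->
  dvdX d (ev F (pt2 a b) - ev F (pt2 a' b')).
Proof.
move=> ha hb ha' hb' Ha Hb; rewrite !ev2E //; apply: evS_cong => // i.
exact: fcomp_cong.
Qed.

End Composition.

(** A right inverse [h] has itself a right inverse, which must equal [g]; hence [h] is two-sided. *)
Lemma comp_inverse_exists (k : fieldType) (g : fps k) :
  dvdX 1 g -> g 1%N != 0 ->
  exists2 h, dvdX 1 h & fcomp g h = fX k /\ fcomp h g = fX k.
Proof.
have right_inv (f : fps k) : dvdX 1 f -> f 1%N != 0 ->
    exists2 h, dvdX 1 h & fcomp f h = fX k.
  (* These are the coefficients of f(y) - x in powers of y. *)
  move=> hf f1; pose A i := fps_const (f i) - (if i is 0 then fX k else 0).
  have [||h hh E] := @fps_hensel k A.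
  - by rewrite /A fcoefB hf // rmorph0 fcoef0 subr0.
  - by rewrite /A fcoefB fcoef0 subr0.
  exists h => //; move: E; rewrite evSB -[X in X - _]/(fcomp f h) => /eqP.
  rewrite subr_eq0 => /eqP ->; rewrite evS_recl // -[RHS]addr0; congr (_ + _).
  rewrite [evS _ _](_ : _ = 0) ?mulr0 //; apply: fpsP => n.
  by rewrite /evS big1 // => i _; rewrite mul0r.
move=> hg g1; have [h hh gh] := right_inv g hg g1.
have h1 : h 1%N != 0.
  have := congr1 (fun f : fps k => f 1%N) gh; rewrite fcomp_recl // fcoefD fcoefM.
  rewrite /fps_const /= add0r !big_ord_recr big_ord0 /= hh // mul0r !add0r.
  rewrite /fX eqxx => /eqP; apply: contraTneq => ->.
  by rewrite mul0r eq_sym oner_eq0.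
have [h' hh' hh'E] := right_inv h hh h1.
exists h; [exact: hh | split; first exact: gh].
suff -> : g = h' by [].
by rewrite -[h']fcomp_fX // -gh fcompA // hh'E fcomp_Xr.
Qed.

Local Opaque ssubst ssubst2 scomp ev evS no_constant_term svar.

(** * The operation that G induces on x R[[x]] *)

Section FormalGroupPoints.
Variables (R : comNzRingType) (G : series R 2).
Hypothesis hG : formal_group_law G.

Definition fgadd (a b : fps R) : fps R := ev G (pt2 a b).
Local Notation gadd := fgadd.

Lemma dvdX_gadd a b : dvdX 1 a -> dvdX 1 b -> dvdX 1 (gadd a b).
Proof.
move=> ha hb; case: hG => G0 _ _ _; apply: dvdX_ev => // i; exact: dvdX_pt2.
Qed.

Lemma gadd0 a : dvdX 1 a -> gadd a 0 = a.
Proof.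
move=> ha; have ha' : forall i : 'I_1, dvdX 1 a by [].
case: hG => _ /boolp.funext H _ _.
have := congr1 (fun F => ev F (fun _ => a)) H.
by rewrite ev_ssubst2 ?ev_svar ?ev_szero //; exact: no_constant_svar.
Qed.

Lemma gadd0l a : dvdX 1 a -> gadd 0 a = a.
Proof.
move=> ha; have ha' : forall i : 'I_1, dvdX 1 a by [].
case: hG => _ _ /boolp.funext H _.
have := congr1 (fun F => ev F (fun _ => a)) H.
by rewrite ev_ssubst2 ?ev_svar ?ev_szero //; exact: no_constant_svar.
Qed.

Lemma no_constant_ssubst2 n (f g : series R n) : no_constant_term f ->
  no_constant_term g -> no_constant_term (ssubst2 G f g).
Proof.
move=> hf hg; case: hG => G0 _ _ _; apply: (no_constant_ssubst G0) => i.
by rewrite /pair2; case: ifP.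
Qed.

Lemma ev_gaddl n (f g h : series R n) a : no_constant_term f ->
  no_constant_term g -> no_constant_term h -> (forall i, dvdX 1 (a i)) ->
  ev (ssubst2 G (ssubst2 G f g) h) a = gadd (gadd (ev f a) (ev g a)) (ev h a).
Proof.
move=> hf hg hh ha; have hfg := no_constant_ssubst2 hf hg.
by rewrite (ev_ssubst2 G hfg hh ha) (ev_ssubst2 G hf hg ha).
Qed.

Lemma ev_gaddr n (f g h : series R n) a : no_constant_term f ->
  no_constant_term g -> no_constant_term h -> (forall i, dvdX 1 (a i)) ->
  ev (ssubst2 G f (ssubst2 G g h)) a = gadd (ev f a) (gadd (ev g a) (ev h a)).
Proof.
move=> hf hg hh ha; have hgh := no_constant_ssubst2 hg hh.
by rewrite (ev_ssubst2 G hf hgh ha) (ev_ssubst2 G hg hh ha).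
Qed.

Lemma gaddA a b c : dvdX 1 a -> dvdX 1 b -> dvdX 1 c ->
  gadd a (gadd b c) = gadd (gadd a b) c.
Proof.
move=> ha hb hc; case: hG => G0 _ _ /boolp.funext.
have : nat_of_ord (inord 0 : 'I_3) = 0 by rewrite inordK.
have : nat_of_ord (inord 1 : 'I_3) = 1 by rewrite inordK.
have : nat_of_ord (inord 2 : 'I_3) = 2 by rewrite inordK.
move: (inord 0) (inord 1) (inord 2) => i j l Hl Hj Hi H.
have [pt [hpt p0 p1 p2]] : exists pt : 'I_3 -> fps R,
    [/\ forall m, dvdX 1 (pt m), pt i = a, pt j = b & pt l = c].
  exists (fun m => nth 0 [:: a; b; c] m); split; rewrite ?Hi ?Hj ?Hl //.
  by case=> -[|[|[|]]].
have sv (m : 'I_3) := no_constant_svar R m.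
have El := ev_gaddl (sv i) (sv j) (sv l) hpt.
have Er := ev_gaddr (sv i) (sv j) (sv l) hpt.
have E := etrans (esym Er) (etrans (congr1 (fun F => ev F pt) (esym H)) El).
by rewrite !(ev_svar _ hpt) p0 p1 p2 in E.
Qed.

Lemma gadd_comp a b c : dvdX 1 a -> dvdX 1 b -> dvdX 1 c ->
  fcomp (gadd a b) c = gadd (fcomp a c) (fcomp b c).
Proof. exact: fcomp_ev2. Qed.

Lemma gadd_cong a b a' b' d :
  dvdX 1 a -> dvdX 1 b -> dvdX 1 a' -> dvdX 1 b' ->
  dvdX d (a - a') -> dvdX d (b - b') -> dvdX d (gadd a b - gadd a' b').
Proof. exact: ev2_cong. Qed.

Lemma ycoef_G0 : ycoef G 0 = fX R.
Proof.
rewrite -[LHS]fcomp_Xr -(evS0 (fun i => fcomp (ycoef G i) (fX R))) -ev2E.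
- by rewrite -/(gadd _ _) gadd0 //; exact: dvdX_fX.
- exact: dvdX_fX.
- exact: dvdX_zero.
Qed.

Lemma ycoef_G_coef0 i : ycoef G i 0%N = fX R i.
Proof.
suff <- : fcomp (fun i => ycoef G i 0%N) (fX R) = fX R by rewrite fcomp_Xr.
rewrite -[RHS](gadd0l (@dvdX_fX R)) /gadd ev2E; first last.
- exact: dvdX_fX.
- exact: dvdX_zero.
by congr (evS _ _); apply: boolp.funext => j; rewrite comp0r.
Qed.

(** The unit W in G(a, b) = a + b W; its constant term is 1. *)
Definition gadd_rem a b := evS (fun i => fcomp (ycoef G i.+1) a) b.

Lemma gaddE a b : dvdX 1 a -> dvdX 1 b -> gadd a b = a + b * gadd_rem a b.
Proof.
move=> ha hb; rewrite /gadd ev2E // evS_recl // ycoef_G0 fcomp_fX //.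
Qed.

Lemma gadd_rem_coef0 a b : dvdX 1 a -> dvdX 1 b -> gadd_rem a b 0%N = 1.
Proof. by move=> ha hb; rewrite /gadd_rem evS_coef0 // fcomp_coef0 // ycoef_G_coef0. Qed.

Lemma gadd_coef1 a b : dvdX 1 a -> dvdX 1 b -> gadd a b 1%N = a 1%N + b 1%N.
Proof.
move=> ha hb; rewrite gaddE // fcoefD fcoefM !big_ord_recr big_ord0 /=.
by rewrite hb // mul0r !add0r gadd_rem_coef0 // mulr1.
Qed.

(** Exhibits g(x, y) + f(x) as one series in two variables. It is used for x + y - x and for psi(x +
    y) - psi(x), which can then be expanded in powers of y. *)
Lemma gadd_ssubst2 f g a b : dvdX 1 f -> dvdX 1 a -> dvdX 1 b ->
  no_constant_term g ->
  ev (ssubst2 G g (scomp (ofF f) (svar (inord 0)))) (pt2 a b) =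
  gadd (ev g (pt2 a b)) (fcomp f a).
Proof.
move=> hf ha hb g0; have hab i : dvdX 1 (pt2 a b i) by exact: dvdX_pt2.
have sv := no_constant_svar R (inord 0 : 'I_2).
have fsv : no_constant_term (scomp (ofF f) (svar (inord 0 : 'I_2))).
  by apply: no_constant_ssubst => [|_]; [exact: dvdX_ofF | exact: sv].
rewrite (ev_ssubst2 _ g0 fsv hab) (ev_scomp _ sv hab) (ev_svar _ hab) ofFK.
have -> : pt2 a b (inord 0) = a by rewrite /pt2 -[inord 0 == _]val_eqE /= inordK.
by [].
Qed.

End FormalGroupPoints.

(** * Inverses and conjugation for G *)

Section FormalGroup.
Variables (k : fieldType) (G : series k 2).
Hypothesis hG : formal_group_law G.
Local Notation gadd := (fgadd G).

(** G(x, y) = 0 is solved for y: its constant term in y is x and its coefficient of y is a unit. *)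
Lemma gopp_exists : exists2 i, dvdX 1 i & gadd (fX k) i = 0.
Proof.
have [||i hi E] := @fps_hensel k (ycoef G).
- by rewrite (ycoef_G0 hG).
- by rewrite (ycoef_G_coef0 hG) oner_eq0.
exists i => //; rewrite /gadd ev2E //; last exact: dvdX_fX.
by rewrite -[RHS]E; congr (evS _ _); apply: boolp.funext => j; exact: fcomp_Xr.
Qed.

Definition fginv : fps k := projT1 (boolp.cid2 gopp_exists).
Definition fgopp a := fcomp fginv a.
Local Notation ginv := fginv.
Local Notation gopp := fgopp.

Lemma dvdX_ginv : dvdX 1 ginv.
Proof. by rewrite /ginv; case: boolp.cid2. Qed.

Lemma dvdX_gopp a : dvdX 1 a -> dvdX 1 (gopp a).
Proof. by move=> ha; apply: dvdX1_comp => //; exact: dvdX_ginv. Qed.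

Lemma gaddN a : dvdX 1 a -> gadd a (gopp a) = 0.
Proof.
move=> ha; rewrite -{1}[a]fcomp_fX // -gadd_comp //.
- rewrite [gadd _ _](_ : _ = 0); last by rewrite /ginv; case: boolp.cid2.
  exact: fcomp_const.
- exact: dvdX_fX.
- exact: dvdX_ginv.
Qed.

Lemma gaddKr a b : dvdX 1 a -> dvdX 1 b -> gadd (gadd a b) (gopp b) = a.
Proof.
move=> ha hb; have hnb := dvdX_gopp hb.
by rewrite -(gaddA hG) // gaddN // (gadd0 hG).
Qed.

Lemma gaddNl a : dvdX 1 a -> gadd (gopp a) a = 0.
Proof.
move=> ha; have hn := dvdX_gopp ha; have hnn := dvdX_gopp hn.
rewrite -{2}[a](gaddKr ha hn) gaddN // (gadd0l hG); last exact: dvdX_gopp.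
exact: gaddN.
Qed.

Lemma gaddKl a b : dvdX 1 a -> dvdX 1 b -> gadd (gopp a) (gadd a b) = b.
Proof.
move=> ha hb; have hna := dvdX_gopp ha.
by rewrite (gaddA hG) // gaddNl // (gadd0l hG).
Qed.

Lemma gadd_inj a b c : dvdX 1 a -> dvdX 1 b -> dvdX 1 c ->
  gadd a b = gadd a c -> b = c.
Proof. by move=> ha hb hc /(congr1 (gadd (gopp a))); rewrite !gaddKl. Qed.

Definition fgconj a b := gadd (gadd a b) (gopp a).
Local Notation gconj := fgconj.

Lemma gconj_ev : exists C : series k 2, forall a b, dvdX 1 a -> dvdX 1 b ->
  gconj a b = ev C (pt2 a b).
Proof.
exists (ssubst2 G G (scomp (ofF ginv) (svar (inord 0)))) => a b ha hb.
rewrite gadd_ssubst2 //; first exact: dvdX_ginv.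
by case: hG.
Qed.

Lemma gconjD a a' b : dvdX 1 a -> dvdX 1 a' -> dvdX 1 b ->
  gconj (gadd a a') b = gconj a (gconj a' b).
Proof.
move=> ha ha' hb; have hna := dvdX_gopp ha; have hna' := dvdX_gopp ha'.
have haa' := dvdX_gadd hG ha ha'; have hc := dvdX_gadd hG hna' hna.
have -> : gconj (gadd a a') b = gadd (gadd (gadd a a') b) (gadd (gopp a') (gopp a)).
  rewrite /gconj; congr (gadd _ _); apply: (gadd_inj haa') => //.
    exact: dvdX_gopp.
  by rewrite gaddN // -(gaddA hG) // (gaddA hG ha') // gaddN // (gadd0l hG) // gaddN.
have hab := dvdX_gadd hG ha' hb.
by rewrite /gconj -!(gaddA hG) //; do ?apply: (dvdX_gadd hG).
Qed.

End FormalGroup.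

Local Opaque fcomp fgadd fgopp.

(** * Commutativity of one-dimensional formal group laws over a field *)

Section Commutativity.
Variables (k : fieldType) (G : series k 2).
Hypothesis hG : formal_group_law G.
Local Notation gadd := (fgadd G).
Local Notation gopp := (fgopp hG).
Local Notation gconj := (fgconj hG).

Lemma dvdX_gconj a b : dvdX 1 a -> dvdX 1 b -> dvdX 1 (gconj a b).
Proof.
move=> ha hb; apply: (dvdX_gadd hG); last exact: dvdX_gopp.
exact: dvdX_gadd.
Qed.

Lemma gconj_comm a b : dvdX 1 a -> dvdX 1 b -> gconj a b = b -> gadd a b = gadd b a.
Proof.
move=> ha hb; rewrite /fgconj => E; have hab := dvdX_gadd hG ha hb.
have hna := dvdX_gopp hG ha; rewrite -{2}E -(gaddA hG) //.
by rewrite gaddNl // (gadd0 hG).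
Qed.

(** Here [c] plays the neutral value of [op]. As [op] is commutative, [phi] takes the same value at
    a + b and b + a, so it sends the commutator [d] to [c]; the nonzero series [phi] - [c] vanishes
    at no other point than 0, whence [d] = 0. *)
Lemma hom_comm (phi : fps k) c (op : fps k -> fps k -> fps k) :
  phi <> fps_const c -> commutative op ->
  (forall a b, dvdX 1 a -> dvdX 1 b ->
     fcomp phi (gadd a b) = op (fcomp phi a) (fcomp phi b)) ->
  (forall x a, dvdX 1 a -> op x (fcomp phi a) = fcomp phi a -> x = fps_const c) ->
  forall a b, dvdX 1 a -> dvdX 1 b -> gadd a b = gadd b a.
Proof.
move=> nphi opC phiD op1 a b ha hb.
have hab := dvdX_gadd hG ha hb; have hba := dvdX_gadd hG hb ha.
have hn := dvdX_gopp hG hba; set d := gadd (gadd a b) (gopp (gadd b a)).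
have hd : dvdX 1 d by exact: dvdX_gadd.
have dE : gadd d (gadd b a) = gadd a b.
  rewrite /d -(gaddA hG) // gaddNl //; exact: (gadd0 hG).
suff d0 : d = 0 by rewrite -dE d0 (gadd0l hG).
have := phiD d (gadd b a) hd hba.
rewrite dE phiD // opC -phiD // => /esym /(op1 _ _ hba) E.
apply: (@fcomp_eq0 _ (phi - fps_const c)) => //.
  by move/eqP; rewrite subr_eq0 => /eqP.
by rewrite fcompB fcomp_const // E subrr.
Qed.

(** Comparison of coefficients of y^q, with y specialised to x^M: [D] is divisible by every x^M. *)
Lemma fps_small_eq0 (D : fps k) q :
  (forall M, (0 < M)%N -> exists t, (fX k ^+ M) ^+ q * D = (fX k ^+ M) ^+ q.+1 * t) ->
  D = 0.
Proof.
move=> H; apply: dvdX_all => d; apply: (@dvdXW _ d.+1) => //.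
have [//|t E] := H d.+1; apply: (dvdX_XnMK (d := (d.+1 * q)%N)).
rewrite exprM E -exprM; apply: dvdXMr; rewrite mulnS addnC; exact: dvdX_Xn.
Qed.

Lemma expr_1Dy (y w : fps k) q : exists v, (1 + y * w) ^+ q = 1 + y * v.
Proof.
elim: q => [|q [v E]]; first by exists 0; rewrite mulr0 addr0.
by exists (v + w * (1 + y * v)); rewrite exprS E; ring.
Qed.

(* Writing x + y - x = sum_i D_i(x) y^i, the first D_q that is not constant is
   a homomorphism from G to the multiplicative group (q = 1) or to the additive
   one (q > 1), hence kills commutators; as D_q - D_q(0) is a nonzero series,
   all commutators vanish. *)
Lemma gaddC a b : dvdX 1 a -> dvdX 1 b -> gadd a b = gadd b a.
Proof.
have [C CE] := gconj_ev hG; pose D i := ycoef C i.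
have conjE x y : dvdX 1 x -> dvdX 1 y ->
    gconj x y = evS (fun i => fcomp (D i) x) y.
  by move=> hx hy; rewrite CE // ev2E.
have h0 : dvdX 1 (0 : fps k) by exact: dvdX_zero.
have hX : dvdX 1 (fX k) by exact: dvdX_fX.
have D00 : D 0%N = 0.
  rewrite -[LHS]fcomp_Xr -(evS0 (fun i => fcomp (D i) (fX k))) -conjE //.
  by rewrite /fgconj (gadd0 hG) // gaddN.
have Dc i : D i 0%N = fX k i.
  suff <- : fcomp (fun i => D i 0%N) (fX k) = fX k by rewrite fcomp_Xr.
  transitivity (gconj 0 (fX k)).
    rewrite conjE //; congr (evS _ _); apply: boolp.funext => j.
    by rewrite comp0r.
  rewrite /fgconj (gadd0l hG) // -[RHS](gadd0 hG) //; congr (gadd _ _).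
  by rewrite -[LHS](gadd0l hG) ?gaddN //; exact: dvdX_gopp.
have : (exists q, D q != fps_const (fX k q)) \/
       (forall q, D q = fps_const (fX k q)).
  case: (boolp.EM (exists q, D q != fps_const (fX k q))) => H; [by left|right=> q].
  by apply/eqP/negPn/negP => Hq; apply: H; exists q.
(* If all D_i are constant, then x + y - x = y and commutativity is immediate. *)
case=> [[q nq]|allc]; last first.
  move=> ha hb; apply: (gconj_comm ha hb); rewrite conjE // -[RHS]fcomp_fX //.
  by congr (evS _ _); apply: boolp.funext => i; rewrite allc fcomp_const.
have {q nq} [q nq min] := ex_minnP (ex_intro (fun q => D q != fps_const (fX k q)) q nq).
have Dlt i x : (i < q)%N -> dvdX 1 x -> fcomp (D i) x = fps_const (fX k i).
  move=> iq hx; rewrite -[RHS](fcomp_const _ hx); congr (fcomp _ x); apply/eqP.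
  by apply/negPn/negP => /min; rewrite leqNgt iq.
have q0 : q != 0%N.
  by apply: contra nq => /eqP ->; rewrite D00; apply/eqP; rewrite rmorph0.
pose E x := fcomp (D q) x.
have expand x y : dvdX 1 x -> dvdX 1 y ->
    exists r, gconj x y = y *+ (1 < q)%N + y ^+ q * (E x + y * r).
  move=> hx hy; exists (evS (fun i => fcomp (D (q + i.+1)%N) x) y).
  rewrite conjE // (evS_split _ q hy) evS_recl // addn0; congr (_ + _).
  rewrite (eq_bigr (fun i : 'I_q => fps_const (fX k i) * y ^+ i)); last first.
    by move=> i _; rewrite Dlt.
  case: q q0 {nq min Dlt E} => [//|[|q]] _.
    by rewrite big_ord1 rmorph0 mul0r.
  rewrite !big_ord_recl rmorph0 mul0r add0r rmorph1 mul1r big1 ?addr0 // => i _.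
  by rewrite mul0r.
have hXM M : (0 < M)%N -> dvdX 1 (fX k ^+ M) by move=> M0; apply: dvdXW (@dvdX_Xn k M).
have hC x y := @dvdX_gconj x y.
have {}nq : D q <> fps_const (fX k q) by apply/eqP.
have [q1|q1] := leqP q 1.
  have {q0 q1} q1 : q = 1%N by lia.
  subst q; apply: (hom_comm (phi := D 1%N) (op := *%R) nq (@mulrC _)).
    move=> x x' hx hx'; apply/eqP; rewrite -subr_eq0; apply/eqP.
    apply: (@fps_small_eq0 _ 1) => M /hXM; move: (fX k ^+ M) => y hy.
    have [r Er] := expand _ _ (dvdX_gadd hG hx hx') hy.
    have [r' Er'] := expand _ _ hx' hy.
    have [s Es] := expand _ _ hx (hC _ _ hx' hy).
    (* Conjugation by x + x' is now expanded in two ways. The coefficients of y give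
       multiplicativity; the terms in y^2 make up the witness that follows. *)
    move: Er; rewrite gconjD // Es Er' /E !expr1 expr2 !add0r => {}Er.
    exists (r' * (fcomp (D 1%N) x) + (fcomp (D 1%N) x' + y * r') ^+ 2 * s - r).
    apply/eqP; rewrite mulrBr subr_eq; apply/eqP.
    have -> : y * fcomp (D 1%N) (gadd x x') =
        y * (fcomp (D 1%N) (gadd x x') + y * r) - y ^+ 2 * r by ring.
    by rewrite -Er; ring.
  move=> x z hz H; apply/eqP; rewrite -subr_eq0; apply/eqP.
  apply: (@fps_mul_eq0 _ (fcomp (D 1%N) z)).
    move/(congr1 (fun f => f 0%N)); rewrite fcomp_coef0 // Dc fcoef0.
    by move/eqP; rewrite oner_eq0.
  by rewrite rmorph1 mulrBr mulr1 mulrC H subrr.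
have cE : fX k q = 0 by rewrite /fX; case: eqP => // q1'; rewrite q1' in q1.
apply: (hom_comm (phi := D q) (op := +%R) nq (@addrC _)).
  move=> x x' hx hx'; apply/eqP; rewrite -subr_eq0; apply/eqP.
  apply: (@fps_small_eq0 _ q) => M /hXM; move: (fX k ^+ M) => y hy.
  have [r Er] := expand _ _ (dvdX_gadd hG hx hx') hy.
  have [r' Er'] := expand _ _ hx' hy.
  have [s Es] := expand _ _ hx (hC _ _ hx' hy).
  move: Er Er' Es; rewrite gconjD // q1 !mulr1n => {}Er Er' Es.
  (* Since q >= 2, the conjugate of y by x' is y (1 + y w), so its q-th power is y^q modulo y^(q+1).
     The coefficients of y^q then give additivity. *)
  pose w := y ^+ q.-2 * (E x' + y * r').
  have yw : gconj x' y = y * (1 + y * w).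
    rewrite Er' /w; case: (q) q1 => [//|[//|p]] _ /=.
    by rewrite !exprS; move: (y ^+ p) => u; ring.
  have [v vE] := expr_1Dy y w q.
  have {}Es : gconj x (gconj x' y) = y + y ^+ q * (E x' + y * r') +
      y ^+ q * (1 + y * v) * (E x + y * (1 + y * w) * s).
    by rewrite Es {2 3}yw exprMn vE -Er'.
  exists (r' + v * E x + (1 + y * v) * (1 + y * w) * s - r).
  rewrite -/(E _) -/(E x) -/(E x').
  have : y ^+ q * (E (gadd x x') + y * r) =
         y ^+ q * (E x' + y * r') + y ^+ q * (1 + y * v) * (E x + y * (1 + y * w) * s).
    by apply: (addrI y); rewrite -Er Es addrA.
  rewrite exprSr; move: (y ^+ q) (E (gadd x x')) (E x) (E x') => Y e1 e2 e3 H.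
  have -> : Y * (e1 - (e2 + e3)) = Y * (e1 + y * r) - Y * (e2 + e3 + y * r) by ring.
  by rewrite H; ring.
by move=> x z hz H; rewrite cE rmorph0; apply: (addIr (fcomp (D q) z)); rewrite add0r.
Qed.

End Commutativity.

(** * Endomorphisms, acting on points *)

Section Endomorphisms.
Variables (R : comNzRingType) (G : series R 2).
Hypothesis hG : formal_group_law G.
Local Notation gadd := (fgadd G).

(** The identity of [fg_End] tested on points, where composites can be computed in one variable;
    [fg_End_fEnd] and [fEnd_fg_End] translate. *)
Definition fEnd (f : fps R) : Prop := dvdX 1 f /\
  forall a b, dvdX 1 a -> dvdX 1 b -> fcomp f (gadd a b) = gadd (fcomp f a) (fcomp f b).

Lemma ev_scomp_G (f : series R 1) a b : dvdX 1 a -> dvdX 1 b ->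
  ev (scomp f G) (pt2 a b) = fcomp (toF f) (gadd a b).
Proof.
move=> ha hb; have hab i : dvdX 1 (pt2 a b i) by exact: dvdX_pt2.
by have G0 : no_constant_term G by [case: hG]; exact: ev_scomp.
Qed.

Lemma ev_ssubst2_scomp (f : series R 1) a b : no_constant_term f ->
  dvdX 1 a -> dvdX 1 b ->
  ev (ssubst2 G (scomp f (svar (inord 0))) (scomp f (svar (inord 1)))) (pt2 a b) =
  gadd (fcomp (toF f) a) (fcomp (toF f) b).
Proof.
move=> hf ha hb; have hab i : dvdX 1 (pt2 a b i) by exact: dvdX_pt2.
have : pt2 a b (inord 0) = a by rewrite /pt2 -[inord 0 == _]val_eqE /= inordK.
have : pt2 a b (inord 1) = b by rewrite /pt2 -[inord 1 == _]val_eqE /= inordK.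
(* [mulp] is here the value of the point at the first index, unrelated to [p]. *)
move: (inord 0) (inord 1) => i j pj mulp.
have sv (l : 'I_2) := no_constant_svar R l.
have fsv l : no_constant_term (scomp f (svar (l : 'I_2))).
  by apply: no_constant_ssubst => // _; exact: sv.
rewrite (ev_ssubst2 _ (fsv i) (fsv j) hab) (ev_scomp _ (sv i) hab).
by rewrite (ev_scomp _ (sv j) hab) (ev_svar i hab) (ev_svar j hab) mulp pj.
Qed.

Lemma fg_End_fEnd (f : series R 1) : fg_End G f -> fEnd (toF f).
Proof.
case=> hf /boolp.funext E; split=> [|a b ha hb]; first exact/dvdX_toF.
by rewrite -ev_scomp_G // E ev_ssubst2_scomp.
Qed.

(** The first argument may be kept equal to x, because [series2_ext] only uses the points (x,
    x^M). *)
Lemma fg_End_of_generic (f : series R 1) : no_constant_term f ->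
  (forall b, dvdX 1 b ->
     fcomp (toF f) (gadd (fX R) b) = gadd (fcomp (toF f) (fX R)) (fcomp (toF f) b)) ->
  fg_End G f.
Proof.
move=> hf H; split=> // e; congr (_ e); apply: series2_ext => M M0.
have hM : dvdX 1 (fX R ^+ M) by apply: dvdXW (@dvdX_Xn R M).
have hX := @dvdX_fX R; rewrite (ev_scomp_G f hX hM) (H _ hM).
by rewrite (ev_ssubst2_scomp hf hX hM).
Qed.

Lemma fEnd_fg_End (f : fps R) : fEnd f -> fg_End G (ofF f).
Proof.
case=> hf H; apply: fg_End_of_generic; first exact: dvdX_ofF.
by move=> b hb; rewrite ofFK; apply: H => //; exact: dvdX_fX.
Qed.

Lemma fEnd_X : fEnd (fX R).
Proof.
split=> [|a b ha hb]; first exact: dvdX_fX.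
by rewrite !fcomp_fX //; exact: dvdX_gadd.
Qed.

Lemma fEnd_comp f g : fEnd f -> fEnd g -> fEnd (fcomp f g).
Proof.
move=> [hf Hf] [hg Hg]; split=> [|a b ha hb]; first exact: dvdX1_comp.
have hga := dvdX1_comp hg ha; have hgb := dvdX1_comp hg hb.
have hab := dvdX_gadd hG ha hb.
rewrite (fcompA f hg hab) (Hg _ _ ha hb) (Hf _ _ hga hgb).
by rewrite (fcompA f hg ha) (fcompA f hg hb).
Qed.

Lemma fEnd_inverse f g : fEnd f -> dvdX 1 g -> fcomp f g = fX R -> fcomp g f = fX R ->
  fEnd g.
Proof.
move=> [hf Hf] hg fg gf; split=> // a b ha hb.
have hga := dvdX1_comp hg ha; have hgb := dvdX1_comp hg hb.
have fgK c : dvdX 1 c -> fcomp f (fcomp g c) = c.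
  by move=> hc; rewrite -(fcompA f hg hc) fg fcomp_fX.
rewrite -{1}(fgK a ha) -{1}(fgK b hb) -(Hf _ _ hga hgb).
by rewrite -(fcompA g hf (dvdX_gadd hG hga hgb)) gf fcomp_fX //; exact: dvdX_gadd.
Qed.

End Endomorphisms.

(** * Series in x^q and endomorphisms in characteristic p *)

Definition powser (R : comNzRingType) q (f : fps R) :=
  forall n, ~~ (q %| n)%N -> f n = 0.

Lemma powser_comp (R : comNzRingType) q (f : fps R) : (0 < q)%N -> powser q f ->
  f = fcomp (fun n => f (q * n)%N) (fX R ^+ q).
Proof.
move=> q0 hf; have hX : dvdX 1 (fX R ^+ q) by apply: dvdXW (@dvdX_Xn R q).
apply: fpsP => n.
have := dvdXB_coef (fcomp_trunc (fun n => f (q * n)%N) hX (leqnn n.+1)) (ltnSn n).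
move=> ->; rewrite fcoef_sum.
under eq_bigr do rewrite fcoefCM -exprM fcoefXn.
case: (boolP (q %| n)%N) => [/dvdnP[m ->]|nq].
  rewrite [(m * q)%N]mulnC; have mn : (m < (q * m).+1)%N by nia.
  rewrite (bigD1 (Ordinal mn)) //= eqxx mulr1 big1 ?addr0 // => i ni.
  rewrite eqn_pmul2l //; case: eqP => [E|]; last by rewrite mulr0.
  by case/eqP: ni; apply: val_inj; exact: esym E.
rewrite hf // big1 // => i _; case: eqP => [E|]; last by rewrite mulr0.
by case/negP: nq; rewrite E dvdn_mulr.
Qed.

Section CharP.
Variables (k : fieldType) (p : nat).
Hypothesis hp : p \in [pchar k].

Lemma pchar_fps : p \in [pchar (fps k)].
Proof. exact: (rmorph_pchar (@fps_const k)). Qed.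

Lemma fps_frobeniusD s (x y : fps k) :
  (x + y) ^+ (p ^ s) = x ^+ (p ^ s) + y ^+ (p ^ s).
Proof.
apply: exprDn_pchar; rewrite pnatX pnatE ?pchar_fps //.
exact: pcharf_prime hp.
Qed.

Lemma powser_frobenius s (f : fps k) : powser (p ^ s) (f ^+ (p ^ s)).
Proof.
move=> n nq; have hX := @dvdX_fX k.
have H := dvdX_congX (p ^ s) (fcomp_trunc f hX (leqnn n.+1)).
rewrite fcomp_Xr in H; rewrite (dvdXB_coef H (ltnSn n)).
have q0 : (0 < p ^ s)%N by rewrite expn_gt0 prime_gt0 // (pcharf_prime hp).
have z0 : (0 : fps k) ^+ (p ^ s) = 0 by rewrite expr0n gtn_eqF.
rewrite (big_morph (fun x : fps k => x ^+ (p ^ s)) (fps_frobeniusD s) z0).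
rewrite fcoef_sum big1 // => i _; rewrite exprMn -rmorphXn fcoefCM -exprM fcoefXn.
case: eqP => [E|]; last by rewrite mulr0.
by case/negP: nq; rewrite E dvdn_mull.
Qed.

Variable G : series k 2.
Hypothesis hG : formal_group_law G.
Local Notation gadd := (fgadd G).

(** Inductively f = f1(x^q) with q = p^s, and f1' = 0 is to be shown, so that f1 is a series in x^p.
    Write G(x, b) = x + b W. By Frobenius, f(G(x, b)) = f1(x^q + b^q W^q), which is f + f1'(x^q) b^q
    W^q modulo b^(2q). It is also f plus a multiple of f(b), and f(b) is 0 modulo b^(2q). Hence b^q
    divides f1'(x^q), for b an arbitrarily high power of x. *)
Lemma fEnd_powser s f : fEnd G f -> dvdX (p ^ s) f -> powser (p ^ s) f.
Proof.
move=> [hf fD]; have p_pr := pcharf_prime hp; have p_gt1 := prime_gt1 p_pr.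
elim: s => [|s IH] hs; first by move=> n; rewrite dvd1n.
set q := (p ^ s)%N in IH; have q0 : (0 < q)%N by rewrite expn_gt0 ltnW.
have sq : (p ^ s.+1 = p * q)%N by rewrite expnS.
have {IH}hq : powser q f by apply: IH; apply: dvdXW hs; rewrite sq; nia.
pose f1 : fps k := fun n => f (q * n)%N.
have hX := @dvdX_fX k; have hXn n : (0 < n)%N -> dvdX 1 (fX k ^+ n).
  by move=> n0; apply: dvdXW (@dvdX_Xn k n).
have hXq := hXn q q0; have fE : f = fcomp f1 (fX k ^+ q) := powser_comp q0 hq.
have compf a : dvdX 1 a -> fcomp f a = fcomp f1 (a ^+ q).
  by move=> ha; rewrite {1}fE (fcompA f1 hXq ha) fcomp_Xn.
suff df0 : fderiv f1 = 0.
  move=> n; rewrite sq => nq; case: (boolP (q %| n)%N) => [/dvdnP[m nE]|]; last exact: hq.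
  have pm : ~~ (p %| m)%N by apply: contra nq => pm; rewrite nE dvdn_mul.
  case: m nE pm => [|m] nE pm; first by rewrite dvdn0 in pm.
  have := congr1 (fun g : fps k => g m) df0; rewrite fcoef0 /fderiv /f1 mulnC -nE.
  move/eqP; rewrite -mulr_natr mulf_eq0 -(dvdn_pcharf hp) (negPf pm) orbF.
  by move/eqP.
apply: boolp.contrapT => df0.
suff /(congr1 (fun g : fps k => g q)) : fX k ^+ q = 0.
  by rewrite fcoefXn eqxx fcoef0 => /eqP; rewrite oner_eq0.
(* A nonzero f1' would not vanish at x^q. *)
apply: (fcomp_eq0 df0 hXq); apply: dvdX_all => M.
case: M => [|M]; first exact: dvdX0.
pose b := fX k ^+ M.+1; have hb : dvdX 1 b by exact: hXn.
pose W := gadd_rem G (fX k) b.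
have W0 : (W ^+ q) 0%N != 0.
  suff -> : (W ^+ q) 0%N = 1 by rewrite oner_eq0.
  elim: (q) => [|n IHn]; first by rewrite expr0 fcoef1.
  rewrite exprS fcoefM big_ord1 subn0 IHn mulr1.
  exact: (gadd_rem_coef0 hG hX hb).
have hbq : dvdX (M.+1 * q) (b ^+ q * W ^+ q).
  by apply: dvdXMr; apply: dvdXX; exact: dvdX_Xn.
have hbq1 : dvdX 1 (b ^+ q * W ^+ q) by apply: dvdXW hbq; nia.
have T := fcomp_taylor f1 hXq hbq1 hbq.
(* The order of f is at least p q, and p >= 2. *)
have hfb : dvdX (M.+1 * q + M.+1 * q) (fcomp f b).
  apply: (@dvdXW _ (M.+1 * p ^ s.+1)%N); first by rewrite sq; nia.
  by apply: dvdX_comp => //; exact: dvdX_Xn.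
have E : fcomp f1 (fX k ^+ q + b ^+ q * W ^+ q) = f + fcomp f b * gadd_rem G f (fcomp f b).
  rewrite -exprMn -fps_frobeniusD -(gaddE hG hX hb) -compf; last exact: dvdX_gadd.
  by rewrite fD // fcomp_Xr (gaddE hG) //; exact: dvdX1_comp.
move: T; rewrite E -fE [f + _]addrC addrK => T.
have {T} := dvdXB (dvdXMr (gadd_rem G f (fcomp f b)) hfb) T.
rewrite subKr mulrCA /b -exprM => /dvdX_XnMK.
rewrite mulrC => /(dvdX_unitMK W0); apply: dvdXW; nia.
Qed.

End CharP.

Section SeriesOrder.
Variable k : fieldType.
Implicit Types f a : fps k.

Lemma fcoef0M f a : (f * a) 0%N = f 0%N * a 0%N.
Proof. by rewrite fcoefM big_ord1. Qed.

Lemma fcoef0X f n : (f ^+ n) 0%N = f 0%N ^+ n.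
Proof.
by elim: n => [|n IH]; rewrite ?expr0 ?fcoef1 // !exprS fcoef0M IH.
Qed.

Lemma fcomp_order f a d e : (0 < e)%N -> dvdX d f -> f d != 0 -> dvdX e a -> a e != 0 ->
  dvdX (e * d) (fcomp f a) /\ fcomp f a (e * d)%N != 0.
Proof.
move=> e0 hf fd ha ae; have ha1 : dvdX 1 a by apply: dvdXW ha.
split; first exact: dvdX_comp.
rewrite (fcomp_shift ha1 hf) {1}(dvdXP ha) exprMn -exprM -mulrA fcoefXnM leqnn subnn.
rewrite fcoef0M fcoef0X fcomp_coef0 // addn0 add0n.
by rewrite mulf_neq0 // expf_neq0.
Qed.

End SeriesOrder.

Local Transparent fgopp.

(** * Sums of endomorphisms and multiplication by integers *)

Section EndomorphismRing.
Variables (k : fieldType) (G : series k 2).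
Hypothesis hG : formal_group_law G.
Local Notation gadd := (fgadd G).
Local Notation gopp := (fgopp hG).
Local Notation ginv := (fginv hG).

Lemma gaddACA a b c d : dvdX 1 a -> dvdX 1 b -> dvdX 1 c -> dvdX 1 d ->
  gadd (gadd a b) (gadd c d) = gadd (gadd a c) (gadd b d).
Proof.
move=> ha hb hc hd.
have hcd := dvdX_gadd hG hc hd; have hbd := dvdX_gadd hG hb hd.
rewrite -(gaddA hG ha hb hcd) (gaddA hG hb hc hd) (gaddC hG hb hc).
by rewrite -(gaddA hG hc hb hd) (gaddA hG ha hc hbd).
Qed.

(** Commutativity of G enters here, through the exchange of the two middle terms. *)
Lemma fEnd_gadd f g : fEnd G f -> fEnd G g -> fEnd G (gadd f g).
Proof.
move=> [hf Hf] [hg Hg]; split=> [|a b ha hb]; first exact: dvdX_gadd.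
have hab := dvdX_gadd hG ha hb.
rewrite (gadd_comp G hf hg hab) (Hf _ _ ha hb) (Hg _ _ ha hb).
rewrite (gadd_comp G hf hg ha) (gadd_comp G hf hg hb).
by apply: gaddACA; exact: dvdX1_comp.
Qed.

Lemma fEnd_ginv : fEnd G ginv.
Proof.
have hi := dvdX_ginv hG; split=> // a b ha hb; rewrite -!/(gopp _).
have [ha' hb'] := (dvdX_gopp hG ha, dvdX_gopp hG hb).
have hab := dvdX_gadd hG ha hb; have hab' := dvdX_gadd hG ha' hb'.
apply: (gadd_inj hG hab (dvdX_gopp hG hab) hab').
rewrite (gaddN hG hab) (gaddACA ha hb ha' hb') (gaddN hG ha) (gaddN hG hb).
by rewrite (gadd0 hG) //; exact: dvdX_zero.
Qed.

Lemma no_constant_fg_mul n : no_constant_term (fg_mul G n).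
Proof.
elim: n => [//|n IH]; apply: (no_constant_ssubst2 hG IH); exact: no_constant_svar.
Qed.

Lemma toF_fg_mulS n : toF (fg_mul G n.+1) = gadd (toF (fg_mul G n)) (fX k).
Proof.
rewrite -toF_svar; apply: toF_ssubst2; first exact: no_constant_fg_mul.
exact: no_constant_svar.
Qed.

Lemma toF_szero : toF (szero : series k 1) = 0.
Proof. by apply: fpsP => n; rewrite fcoef0. Qed.

Lemma fEnd_fg_mul n : fEnd G (toF (fg_mul G n)).
Proof.
elim: n => [|n IH]; last by rewrite toF_fg_mulS; apply: fEnd_gadd IH (fEnd_X hG).
have h0 := @dvdX_zero k 1; rewrite toF_szero; split=> // a b ha hb.
have comp0 c : dvdX 1 c -> fcomp 0 c = 0 by exact: fcomp_const.
by rewrite !comp0 ?(gadd0 hG) //; exact: dvdX_gadd.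
Qed.

Lemma fg_mul_coef1 n : toF (fg_mul G n) 1%N = n%:R.
Proof.
elim: n => [//|n IH]; rewrite toF_fg_mulS (gadd_coef1 hG) ?IH ?natr1 //.
  by apply/dvdX_toF; exact: no_constant_fg_mul.
exact: dvdX_fX.
Qed.

End EndomorphismRing.

(** * A series normalizing the automorphisms is an endomorphism *)

Section Normalizer.
Variables (k : fieldType) (p : nat).
Hypothesis hp : p \in [pchar k].
Variable G : series k 2.
Hypothesis hG : formal_group_law G.
Variable h : nat.
Hypothesis hh : has_height p G h.
Local Notation gadd := (fgadd G).
Local Notation gopp := (fgopp hG).
Local Notation ginv := (fginv hG).

Let mulp := toF (fg_mul G p).

Lemma mulp_order : dvdX (p ^ h) mulp /\ mulp (p ^ h)%N != 0.
Proof.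
case: hh => [[e ed fe] H]; split=> [n nd|]; first by apply: H; rewrite mdeg_multinom1.
by rewrite /mulp /toF -ed multinom1_mdeg.
Qed.

(** At height 0 the linear coefficient of [p] would be nonzero, but it is p = 0. *)
Lemma height_gt0 : (0 < h)%N.
Proof.
have [_] := mulp_order; case: (h) => //.
by rewrite expn0 /mulp fg_mul_coef1 // (pcharf0 hp) eqxx.
Qed.

(** [p^n] as an iterate of [p]: orders multiply under composition, which gives p^(hn). *)
Definition pow_p n := iter n (fcomp mulp) (fX k).

Lemma fEnd_pow_p n : fEnd G (pow_p n).
Proof.
elim: n => [|n IH]; first exact: fEnd_X.
exact: (fEnd_comp hG (fEnd_fg_mul hG p) IH).
Qed.

Lemma pow_p_order n : dvdX (p ^ (h * n)) (pow_p n) /\ pow_p n (p ^ (h * n))%N != 0.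
Proof.
have p0 : (0 < p)%N by rewrite prime_gt0 // (pcharf_prime hp).
elim: n => [|n [IH1 IH2]].
  by rewrite muln0 expn0; split; [exact: dvdX_fX | rewrite /= /fX oner_eq0].
have [mulp1 mulp2] := mulp_order.
have q0 : (0 < p ^ (h * n))%N by rewrite expn_gt0 p0.
have := fcomp_order q0 mulp1 mulp2 IH1 IH2.
by rewrite -expnD -mulnSr.
Qed.

Lemma pow_p_order_gt n : (n < p ^ (h * n))%N.
Proof.
have p1 := prime_gt1 (pcharf_prime hp).
apply: leq_trans (ltn_expl n p1) _; apply: leq_pexp2l; first exact: ltnW.
by rewrite leq_pmull // height_gt0.
Qed.

Section Psi.
Variables psi phi : fps k.
Hypotheses (hpsi : dvdX 1 psi) (hphi : dvdX 1 phi).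
Hypothesis psiK : fcomp psi phi = fX k.

(** With eps = u - 1, the left side of the conclusion is eps(psi). The first equality below is used
    to bound the order of eps: u is the conjugate by psi of x + z, and it agrees with psi(phi(x)) =
    x modulo x^q because z = [p^n] has order q. *)
Lemma conj_pow_p n u : fEnd G u ->
  fcomp u psi = fcomp psi (gadd (fX k) (pow_p n)) ->
  exists2 chi, dvdX 1 chi &
    gadd (fcomp psi (gadd (fX k) (pow_p n))) (gopp psi) = fcomp chi (pow_p n).
Proof.
move=> uD uE; set z := pow_p n in uE *; set s := (h * n)%N; set q := (p ^ s)%N.
have [zq zq0] : dvdX q z /\ z q != 0 by exact: pow_p_order.
have [hz _] := fEnd_pow_p n; have [hu _] := uD.
have q0 : (0 < q)%N by rewrite expn_gt0 prime_gt0 // (pcharf_prime hp).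
have hX := @dvdX_fX k; have hXq : dvdX 1 (fX k ^+ q) by apply: dvdXW (@dvdX_Xn k q).
have hi := dvdX_ginv hG; have hXz := dvdX_gadd hG hX hz.
pose eps := gadd u ginv.
have epsD : fEnd G eps by apply: fEnd_gadd => //; exact: fEnd_ginv.
have heps : dvdX q eps.
  have uX : dvdX q (u - fX k).
    rewrite -[u]fcomp_Xr -psiK -(fcompA u hpsi hphi) uE -{2}[psi]fcomp_Xr -fcompB.
    rewrite -[q]mul1n; apply: dvdX_comp => //; apply: fcomp_cong => //.
    rewrite (gaddE hG hX hz) [fX k + _]addrC addrK; exact: dvdXMr.
  have g0 : gadd (fX k) ginv = 0.
    by rewrite -[RHS](gaddN hG hX) /fgopp fcomp_Xr.
  rewrite -[eps]subr0 -g0; apply: gadd_cong => //.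
  by rewrite subrr; exact: dvdX_zero.
pose e1 : fps k := fun i => eps (q * i)%N.
pose z1 : fps k := fun i => z (q * i)%N.
pose psi1 : fps k := fun i => (psi ^+ q) (q * i)%N.
have epsE : eps = fcomp e1 (fX k ^+ q).
  exact: (powser_comp q0 (fEnd_powser hp hG epsD heps)).
have zE : z = fcomp z1 (fX k ^+ q).
  exact: (powser_comp q0 (fEnd_powser hp hG (fEnd_pow_p n) zq)).
have psiE : psi ^+ q = fcomp psi1 (fX k ^+ q).
  exact: (powser_comp q0 (@powser_frobenius _ _ hp s psi)).
have hz1 : dvdX 1 z1 by move=> [|//] _; rewrite /z1 muln0; apply: hz.
have z11 : z1 1%N != 0 by rewrite /z1 muln1.
have [v hv [_ vz]] := comp_inverse_exists hz1 z11.
have he1 : dvdX 1 e1.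
  by move=> [|//] _; rewrite /e1 muln0; case: epsD => he _; apply: he.
have hpsi1 : dvdX 1 psi1.
  move=> [|//] _; rewrite /psi1 muln0 fcoef0X hpsi // expr0n gtn_eqF //.
have hpv := dvdX1_comp hpsi1 hv.
(* eps(psi) = e1(psi^q) = e1(psi1(x^q)), and x^q = v(z) since v inverts z1. *)
exists (fcomp e1 (fcomp psi1 v)); first exact: dvdX1_comp.
have Xq : fcomp v z = fX k ^+ q by rewrite zE -(fcompA v hz1 hXq) vz fcomp_fX.
rewrite (fcompA e1 hpv hz) (fcompA psi1 hv hz) Xq -psiE -uE.
rewrite -(fcomp_Xn q hpsi) -(fcompA e1 hXq hpsi) -epsE.
by rewrite (gadd_comp G hu hi hpsi).
Qed.

(** The index starts at [n.+1] because 1 + [p^0] = [2] is not invertible when p = 2. *)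
Hypothesis normal : forall n, exists2 u, fEnd G u &
  fcomp u psi = fcomp psi (gadd (fX k) (pow_p n.+1)).

(* psi(x + y) - psi(x) = sum_i P_i(x) y^i and a series chi(y) over k take the
   same value at y = [p^n](x), whose order tends to infinity with n: this
   forces every P_i to be constant. *)
Lemma normalizer_fEnd b : dvdX 1 b ->
  fcomp psi (gadd (fX k) b) = gadd (fcomp psi (fX k)) (fcomp psi b).
Proof.
have hX := @dvdX_fX k; have h0 := @dvdX_zero k 1.
have hi := dvdX_ginv hG; have hnpsi := dvdX_gopp hG hpsi.
have G0 : no_constant_term G by case: hG.
have g0 : no_constant_term (scomp (ofF psi) G).
  by apply: no_constant_ssubst => [|_]; [exact: dvdX_ofF | exact: G0].
have [P PE] : exists P : nat -> fps k, forall a c, dvdX 1 a -> dvdX 1 c ->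
    gadd (fcomp psi (gadd a c)) (fcomp (gopp psi) a) = evS (fun i => fcomp (P i) a) c.
  exists (ycoef (ssubst2 G (scomp (ofF psi) G) (scomp (ofF (gopp psi)) (svar (inord 0))))).
  move=> a c ha hc; rewrite -(ev2E _ ha hc) (gadd_ssubst2 G hnpsi ha hc g0).
  by rewrite (ev_scomp_G hG _ ha hc) ofFK.
(* At x = 0 the expansion reads psi(y) - psi(0) = psi(y). *)
have P0 i : P i 0%N = psi i.
  suff <- : fcomp (fun i => P i 0%N) (fX k) = psi by rewrite fcomp_Xr.
  transitivity (evS (fun i => fcomp (P i) 0) (fX k)).
    congr (evS _ _); apply: boolp.funext => j; by rewrite comp0r.
  rewrite -PE // (gadd0l hG hX) fcomp_Xr comp0r hnpsi // rmorph0.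
  exact: gadd0.
have PX c : dvdX 1 c -> gadd (fcomp psi (gadd (fX k) c)) (gopp psi) = evS P c.
  move=> hc; rewrite -[gopp psi]fcomp_Xr PE //; congr (evS _ _).
  by apply: boolp.funext => j; exact: fcomp_Xr.
have [chi chiE] : exists chi : nat -> fps k, forall n,
    evS P (pow_p n.+1) = fcomp (chi n) (pow_p n.+1).
  suff /boolp.choice : forall n, exists c, evS P (pow_p n.+1) = fcomp c (pow_p n.+1).
    by case=> c Hc; exists c.
  move=> n.
  have [u uD uE] := normal n; have [c _ cE] := conj_pow_p uD uE.
  by exists c; rewrite -cE PX //; case: (fEnd_pow_p n.+1).
(* Both halves are needed at smaller indices: they cancel all terms below [i] in the difference of
   the two expansions, for every [n]. *)
have Pc i : P i = fps_const (psi i) /\ forall n, chi n i = psi i.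
  elim/ltn_ind: i => i IH.
  have small n : dvdX (p ^ (h * n.+1)) (P i - fps_const (chi n i)).
    have [hz _] := fEnd_pow_p n.+1; have [zq zq0] := pow_p_order n.+1.
    set z := pow_p n.+1 in hz zq zq0 *.
    pose A j := P j - fps_const (chi n j).
    have Az : evS A z = 0.
      by rewrite evSB; apply/eqP; rewrite subr_eq0; apply/eqP/chiE.
    have A0 j : (j < i)%N -> A j = 0.
      by move=> /IH [Pj Cj]; rewrite /A Pj Cj subrr.
    (* After division by z^i, the remaining equation shows that z divides P_i - chi_i. *)
    rewrite (evS_split0 hz A0) evS_recl // addn0 in Az.
    have z0 : z <> 0 by move=> E; move: zq0; rewrite E fcoef0 eqxx.
    have /eqP := fps_mul_eq0 (@fps_exp_neq0 _ _ i z0) Az.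
    rewrite addr_eq0 => /eqP; rewrite /A => ->; apply: dvdXN; exact: dvdXMr.
  (* Comparison of constant terms; then P_i - psi_i has arbitrarily large order. *)
  have C n : chi n i = psi i.
    have := dvdXB_coef (small n) (n := 0%N); rewrite P0 => -> //.
    by apply: leq_ltn_trans (pow_p_order_gt n.+1).
  split=> //; apply: eq_mod_dvdX => d; rewrite -(C d).
  apply: dvdXW (small d); apply: ltnW; apply: ltnW; exact: pow_p_order_gt.
move=> hb; have hpb := dvdX1_comp hpsi hb; have hXb := dvdX_gadd hG hX hb.
have hpXb := dvdX1_comp hpsi hXb.
have PcE : P = fun i => fps_const (psi i).
  by apply: boolp.funext => i; case: (Pc i).
have := PX b hb; rewrite PcE evS_const => E.
rewrite fcomp_Xr (gaddC hG hpsi hpb) -E -(gaddA hG hpXb hnpsi hpsi).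
by rewrite (gaddNl hG hpsi) (gadd0 hG hpXb).
Qed.

End Psi.
End Normalizer.

(** * Automorphisms as series, and their membership in the normalizer *)

Section Automorphisms.
Variables (k : fieldType) (G : series k 2).
Hypothesis hG : formal_group_law G.

Definition fAut (f : fps k) : Prop := fEnd G f /\
  exists2 g, fEnd G g & fcomp f g = fX k /\ fcomp g f = fX k.

Lemma comp_inverse_toF (f g : series k 1) : no_constant_term f ->
  comp_inverse f g <->
  dvdX 1 (toF g) /\ fcomp (toF f) (toF g) = fX k /\ fcomp (toF g) (toF f) = fX k.
Proof.
move=> hf; split=> [[hg /boolp.funext fg /boolp.funext gf]|[hg [fg gf]]].
  by rewrite -!toF_scomp // fg gf toF_svar; split=> //; exact/dvdX_toF.
move/dvdX_toF: hg => hg; split=> // e; congr (_ e); apply: toF_inj.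
  by rewrite toF_scomp // fg toF_svar.
by rewrite toF_scomp // gf toF_svar.
Qed.

Lemma fg_Aut_toF (f : series k 1) : fg_Aut G f <-> fAut (toF f).
Proof.
split=> [[fE [g gE ci]]|[fD [g gD [fg gf]]]].
  have [[hf _] [hg _]] := (fE, gE); split; first exact: fg_End_fEnd.
  exists (toF g); first exact: fg_End_fEnd.
  by have [_ []] := (comp_inverse_toF g hf).1 ci.
have fE : fg_End G f by rewrite -[f]toFK; exact: fEnd_fg_End.
split=> //; exists (ofF g); first exact: fEnd_fg_End.
have [hf _] := fE; have [hg _] := gD.
by apply/(comp_inverse_toF _ hf); rewrite ofFK.
Qed.

Lemma fAut_comp f g : fAut f -> fAut g -> fAut (fcomp f g).
Proof.
move=> [fD [f' f'D [ff' f'f]]] [gD [g' g'D [gg' g'g]]].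
have [[hf _] [hg _] [hf' _] [hg' _]] := And4 fD gD f'D g'D.
split; first exact: fEnd_comp.
exists (fcomp g' f'); first exact: fEnd_comp.
have hgf := dvdX1_comp hg' hf'; have hfg := dvdX1_comp hf hg.
rewrite (fcompA f hg hgf) -(fcompA g hg' hf') gg' (fcomp_fX hf') ff'; split=> //.
by rewrite (fcompA g' hf' hfg) -(fcompA f' hf hg) f'f (fcomp_fX hg).
Qed.

Lemma fcomp_coef1 (f a : fps k) : dvdX 1 f -> dvdX 1 a ->
  fcomp f a 1%N = f 1%N * a 1%N.
Proof.
move=> hf ha; rewrite fcomp_recl // hf // rmorph0 add0r fcoefM.
rewrite !big_ord_recr big_ord0 /= ha // mul0r !add0r.
by rewrite fcomp_coef0 // mulrC.
Qed.

Lemma invertible_series_toF (f : series k 1) :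
  invertible_series f <-> dvdX 1 (toF f) /\ toF f 1%N != 0.
Proof.
have E : [multinom 1%N | _ < 1] = U_(ord0)%MM :> 'X_{1..1}.
  by apply/mnmP => i; rewrite mnmE mnm1E (ord1 i).
rewrite /invertible_series /toF E; split=> -[/dvdX_toF hf f1]; split=> //.
Qed.

Lemma fAut_invertible (f : series k 1) : fAut (toF f) -> invertible_series f.
Proof.
move=> [[hf _] [g [hg _] [fg _]]]; apply/invertible_series_toF; split=> //.
have := fcomp_coef1 hf hg; rewrite fg => /eqP; apply: contraTneq => ->.
by rewrite mul0r oner_eq0.
Qed.

Lemma fg_Aut_in_normalizer psi : fg_Aut G psi -> in_normalizer (fg_Aut G) psi.
Proof.
move=> A; have [psiE [phi phiE ci]] := A; have [h0 _] := psiE.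
have fA := (fg_Aut_toF _).1 A; split; first exact: fAut_invertible.
have [h0' _] := phiE; have [hf' [fg gf]] := (comp_inverse_toF phi h0).1 ci.
have hf : dvdX 1 (toF psi) by exact/dvdX_toF.
have fA' : fAut (toF phi).
  split; first exact: fg_End_fEnd.
  by exists (toF psi); first exact: fg_End_fEnd.
exists phi; first exact: ci.
move=> u /invertible_series_toF[hu _].
have hu0 : no_constant_term u by exact/dvdX_toF.
have E : toF (scomp (scomp psi u) phi) = fcomp (fcomp (toF psi) (toF u)) (toF phi).
  by rewrite (toF_scomp _ h0') (toF_scomp _ hu0).
split=> [/fg_Aut_toF uA|/fg_Aut_toF]; first apply/fg_Aut_toF.
  by rewrite E; apply: fAut_comp fA'; exact: fAut_comp fA uA.
rewrite E => wA; apply/fg_Aut_toF.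
(* For the converse, u is recovered by conjugating back with [phi]. *)
suff -> : toF u =
  fcomp (fcomp (toF phi) (fcomp (fcomp (toF psi) (toF u)) (toF phi))) (toF psi).
  by apply: fAut_comp fA; exact: fAut_comp fA' wA.
have hpu := dvdX1_comp hf hu; have hpup := dvdX1_comp hpu hf'.
rewrite (fcompA _ hpup hf) (fcompA _ hf' hf) gf fcomp_Xr.
by rewrite -(fcompA _ hf hu) gf fcomp_fX.
Qed.

End Automorphisms.

(** * Stability of the automorphisms under conjugation forces membership *)

Section SelfNormalizing.
Variables (k : fieldType) (p : nat).
Hypothesis hp : p \in [pchar k].
Variable G : series k 2.
Hypothesis hG : formal_group_law G.
Variable h : nat.
Hypothesis hh : has_height p G h.

(** [p^(n+1)] has order greater than 1, so the linear coefficient of the sum is 1; the inverse under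
    composition of an endomorphism is again one. *)
Lemma fAut_1Dpow_p n : fAut G (fgadd G (fX k) (pow_p p G n.+1)).
Proof.
have zD := fEnd_pow_p p hG n.+1; have [hz _] := zD; have hX := @dvdX_fX k.
have uD := fEnd_gadd hG (fEnd_X hG) zD; have [hu _] := uD.
have u1 : fgadd G (fX k) (pow_p p G n.+1) 1%N != 0.
  rewrite (gadd_coef1 hG hX hz) [pow_p _ _ _ _](_ : _ = 0) ?addr0 ?oner_eq0 //.
  have [H _] := pow_p_order hp hh n.+1; apply: H.
  by apply: leq_ltn_trans (pow_p_order_gt hp hG hh n.+1).
have [v hv [uv vu]] := comp_inverse_exists hu u1.
by split; [exact: uD | exists v; [exact: (fEnd_inverse hG uD hv uv vu) | split]].
Qed.

(** The inclusion of the conjugate of Aut(G) in Aut(G) is applied to the elements 1 + [p^(n+1)],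
    whose conjugates supply the endomorphisms u with u(psi) = psi(1 + [p^(n+1)]). *)
Lemma conj_stable_fg_Aut (psi phi : series k 1) : invertible_series psi ->
  comp_inverse psi phi ->
  (forall u, fg_Aut G u -> fg_Aut G (scomp (scomp psi u) phi)) -> fg_Aut G psi.
Proof.
move=> [psi0 _] ci H; have [hphi [fg gf]] := (comp_inverse_toF phi psi0).1 ci.
have hpsi : dvdX 1 (toF psi) by exact/dvdX_toF.
have phi0 : no_constant_term phi by exact/dvdX_toF.
have normal n : exists2 u, fEnd G u &
    fcomp u (toF psi) = fcomp (toF psi) (fgadd G (fX k) (pow_p p G n.+1)).
  have uA := fAut_1Dpow_p n; have [[hu _] _] := uA.
  set u := fgadd _ _ _ in uA hu *.
  have hu0 := dvdX_ofF hu.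
  have uA' : fg_Aut G (ofF u) by apply/(fg_Aut_toF hG); rewrite ofFK.
  have [wD _] := (fg_Aut_toF hG _).1 (H _ uA').
  move: wD; rewrite (toF_scomp _ phi0) (toF_scomp _ hu0) ofFK => wD.
  exists (fcomp (fcomp (toF psi) u) (toF phi)); first exact: wD.
  by rewrite (fcompA _ hphi hpsi) gf fcomp_Xr.
have psiE : fg_End G psi.
  apply: (fg_End_of_generic hG psi0) => b hb.
  exact: (normalizer_fEnd hp hG hh hpsi hphi fg normal hb).
have psiD := fg_End_fEnd hG psiE.
split; first exact: psiE.
exists phi; last exact: ci.
rewrite -[phi]toFK; apply: (fEnd_fg_End hG).
exact: (fEnd_inverse hG psiD hphi fg gf).
Qed.

End SelfNormalizing.

Theorem theorem4p1 (k : fieldType) (p : nat) (hp : p \in [pchar k])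
  (G : series k 2) (hG : formal_group_law G)
  (hh : exists h : nat, has_height p G h)
  (kbar : closedFieldType) (iota : {rmorphism k -> kbar})
  (halg : forall z : kbar, algebraicOver iota z)
  (hEnd : forall f : series kbar 1, fg_End (smap iota G) f ->
     exists g : series k 1, f =1 smap iota g) :
  (forall psi : series k 1, in_normalizer (fg_Aut G) psi <-> fg_Aut G psi) /\
  (forall psi psi_inv : series k 1,
     invertible_series psi -> comp_inverse psi psi_inv ->
     (forall u : series k 1, fg_Aut G u ->
        fg_Aut G (scomp (scomp psi u) psi_inv)) ->
     fg_Aut G psi).
Proof.
case: hh => h ht; split=> [psi|psi phi]; last exact: (conj_stable_fg_Aut hp hG ht).
(* [psi_inv] names the invertibility of psi, and [phi] is the inverse series. [H] speaks of
   invertible series only, so an automorphism [u] must first be seen to be one. *)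
split=> [[psi_inv [phi ci H]]|]; last exact: fg_Aut_in_normalizer.
apply: (conj_stable_fg_Aut hp hG ht psi_inv ci) => u uA.
have ui : invertible_series u by apply: (@fAut_invertible _ G); exact/(fg_Aut_toF hG).
exact: (H u ui).1 uA.
Qed.
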